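(* Provided the Laplace integrals below and the termwise integrals $\int_{0}^{\infty}e^{-st}t^{\gamma+\frac a2 k-1}dt=\frac{\Gamma\left(\gamma+\frac a2 k\right)}{s^{\gamma+\frac a2 k}}$, $k\ge0$ (with $\gamma=\frac b2$ for the first formula and $\gamma=\frac{b+1}{2}$ for the second), exist and the resulting series converges, it holds that $$\int_{0}^{\infty}e^{-st}t^{\frac b2-1}E_{a,b}\left(xt^{\frac a2}\right)dt=\frac{\sqrt{\pi}}{2^{b-1}s^{\frac b2}}E_{\frac a2,\frac{b+1}{2}}\left(\frac{x}{(4s)^{\frac a2}}\right)$$ and $$\int_{0}^{\infty}e^{-st}t^{\frac{b+1}{2}-1}E_{a,b}\left(xt^{\frac a2}\right)dt=\frac{\sqrt{\pi}}{2^{b-1}s^{\frac{b+1}{2}}}E_{\frac a2,\frac{b}{2}}\left(\frac{x}{(4s)^{\frac a2}}\right).$$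
   Context: The Mittag-Leffler function is $E_{a,b}(z)=\sum_{k=0}^{\infty}\frac{z^{k}}{\Gamma(b+ak)}$ for $\operatorname{Re}(a)>0$ and complex $b$, with $1/\Gamma$ the entire reciprocal Gamma function. Here $s$ is the Laplace transform variable and $x$ is a parameter. *)

(* Defs.v *)
From HB Require Import structures.
From mathcomp Require Import all_boot all_order all_algebra.
From mathcomp Require Import all_classical all_reals all_analysis.
From mathcomp Require Import complex.

Set Implicit Arguments.
Unset Strict Implicit.
Unset Printing Implicit Defensive.

Import Order.TTheory GRing.Theory Num.Theory.
Import numFieldNormedType.Exports.

Local Open Scope classical_set_scope.
Local Open Scope complex_scope.
Local Open Scope ring_scope.

Section ComplexFunctions.
Variable R : realType.
Implicit Types (z w a b s : R[i]) (t : R).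

Definition cexp z : R[i] :=
  (expR (complex.Re z))%:C * (cos (complex.Im z) +i* sin (complex.Im z)).

(* Modulus, as a real number (`|z| itself lives in R[i]). *)
Definition cmod z : R := complex.Re `|z|.

(* Principal argument, with values in ]-pi, pi]. *)
Definition carg z : R :=
  let theta := acos (complex.Re z / cmod z) in
  if 0 <= complex.Im z then theta else - theta.

Definition clog z : R[i] := ln (cmod z) +i* carg z.

(* Principal branch of z ^ w, with the convention 0 ^ 0 = 1 and 0 ^ w = 0 for
   w != 0 (as for powR). *)
Definition cpow z w : R[i] :=
  if z == 0 then (w == 0)%:R else cexp (w * clog z).

(* Limits in R[i] are taken in R[i]^o, whose topology is that of the modulus. *)

(* The entire function 1/Gamma, by Euler's limit formula
     1/Gamma(z) = lim_n z (z + 1) ... (z + n) / (n! n^z),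
   which converges for every complex z and vanishes at 0, -1, -2, ... *)
Definition rGamma_seq z (n : nat) : R[i] :=
  (\prod_(0 <= j < n.+1) (z + j%:R)) / ((n`!)%:R * cpow n%:R z).

Definition rGamma z : R[i] := limn (rGamma_seq z : nat -> R[i]^o).

Definition Gamma z : R[i] := (rGamma z)^-1.

Definition mittag_leffler a b z : R[i] :=
  limn (series (fun k : nat => z ^+ k * rGamma (b + a * k%:R) : R[i]^o)).

(* Complex-valued functions are Lebesgue-integrated componentwise. *)
Definition cintegrable (D : set R) (f : R -> R[i]) : Prop :=
  (@lebesgue_measure R).-integrable D (fun t => (complex.Re (f t))%:E) /\
  (@lebesgue_measure R).-integrable D (fun t => (complex.Im (f t))%:E).

Definition cintegral (D : set R) (f : R -> R[i]) : R[i] :=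
  (\int[@lebesgue_measure R]_(t in D) complex.Re (f t))%R +i*
  (\int[@lebesgue_measure R]_(t in D) complex.Im (f t))%R.

(* The integrals are Lebesgue integrals, so existence means absolute
   convergence. *)
Definition laplace_exists (f : R -> R[i]) s : Prop :=
  cintegrable `]0, +oo[ (fun t => cexp (- s * t%:C) * f t).

Definition laplace (f : R -> R[i]) s : R[i] :=
  cintegral `]0, +oo[ (fun t => cexp (- s * t%:C) * f t).

End ComplexFunctions.

(* Main.v *)
Require Import Defs.
From HB Require Import structures.
From mathcomp Require Import all_boot all_order all_algebra.
From mathcomp Require Import all_classical all_reals all_analysis.
From mathcomp Require Import complex.
From mathcomp Require Import measurable_realfun.
From mathcomp Require Import ring lra.

Set Implicit Arguments.
Unset Strict Implicit.
Unset Printing Implicit Defensive.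

Import Order.TTheory GRing.Theory Num.Theory.
Import numFieldNormedType.Exports.

Local Open Scope classical_set_scope.
Local Open Scope complex_scope.
Local Open Scope ring_scope.

(** Integrate the series of [E_{a,b}] term by term. With [alpha = a/2] and
    [beta = b/2] (or [(b+1)/2]), the [k]-th term is

      [x^k / Gamma(b + ak) * Gamma(beta + alpha k) / s^(beta + alpha k)],

    and Legendre's duplication formula at [z = b + ak] cancels the Gamma in the
    numerator, leaving a constant times [y^k / Gamma(beta' + alpha k)], where
    [beta'] is the other one of [b/2], [(b+1)/2] and [y = x / (4s)^alpha]
    ([prefactor_term]). Three ingredients make this rigorous.

    The Laplace transform of [t^(z-1)] is [Gamma(z) / s^z] for [Re z > 0] and
    [Re s > 0] ([Gint_Gamma]). For real [s], dominated convergence of Euler's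
    integrals of [(1 - t/m)^n t^(z-1)] from 0 to [m] identifies the integral with
    the limit of the reciprocals of Euler's sequence ([cvg_rGamma_seqV]).
    Comparing [|z + j|] with [Re z + j] factor by factor shows that this limit is
    not 0 ([Gint_neq0]), which gives convergence of the sequence defining
    [1/Gamma], first for [Re z > 0] and then everywhere. For complex [s], the
    integral times [s^z] has derivative 0 along vertical lines ([Gint_vline]).

    The duplication formula ([rGamma_duplication]) is an identity between Euler
    sequences, up to a power that tends to [2^z] and a factor independent of [z].
    The limit of that factor is computed at [z = 1] from [Gamma(1/2) = sqrt pi],
    that is, from the Gauss integral.

    The interchange of sum and integral ([laplace_mittag_leffler]) is one more
    dominated convergence. For real [u > 0] the mass of the Gamma integral on
    [M, M+1] gives [1/Gamma(u) <= u e^(M+1) M^(-u)] for all [M > 0], and the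
    factorwise comparison above extends this, up to a geometric factor, to the
    progressions [beta + alpha k]. After the duplication formula one reciprocal
    Gamma absorbs [t^(Re alpha * k)], with [M] linear in [t], and the other one
    makes the bounds summable ([term_le]).

    That [Re s > 0] and [Re beta > 0] follows from existence of the termwise
    integrals ([laplace_exists_half_planes]). *)

Local Notation Re := complex.Re.
Local Notation Im := complex.Im.

(** * Modulus and limits of complex sequences *)

Section ComplexBasics.
Variable R : realType.
Implicit Types (z w : R[i]) (t x : R).

Lemma Re_mul z w : Re (z * w) = Re z * Re w - Im z * Im w.
Proof. by case: z; case: w. Qed.

Lemma Im_mul z w : Im (z * w) = Re z * Im w + Im z * Re w.
Proof. by case: z; case: w. Qed.

Lemma Re_add z w : Re (z + w) = Re z + Re w.
Proof. by case: z; case: w. Qed.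

Lemma Im_add z w : Im (z + w) = Im z + Im w.
Proof. by case: z; case: w. Qed.

Lemma Re_opp z : Re (- z) = - Re z.
Proof. by case: z. Qed.

Lemma Im_opp z : Im (- z) = - Im z.
Proof. by case: z. Qed.

Lemma Re_mulR t z : Re (t%:C * z) = t * Re z.
Proof. by rewrite Re_mul /= mul0r subr0. Qed.

Lemma Im_mulR t z : Im (t%:C * z) = t * Im z.
Proof. by rewrite Im_mul /= mul0r addr0. Qed.

Lemma natC n : n%:R = (n%:R : R)%:C :> R[i].
Proof. by rewrite rmorph_nat. Qed.

Lemma Re_nat n : Re (n%:R : R[i]) = n%:R.
Proof. by rewrite natC. Qed.

Lemma Im_nat n : Im (n%:R : R[i]) = 0.
Proof. by rewrite natC. Qed.

Definition cReE := (Re_mulR, Re_mul, Re_add, Re_opp, Re_nat).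
Definition cImE := (Im_mulR, Im_mul, Im_add, Im_opp, Im_nat).

Lemma complex_eq z w : Re z = Re w -> Im z = Im w -> z = w.
Proof. by case: z => a b; case: w => c d /= -> ->. Qed.

Lemma cmodE z : cmod z = Num.sqrt (Re z ^+ 2 + Im z ^+ 2).
Proof. by rewrite /cmod normc_def. Qed.

Lemma norm_cmod z : `|z| = (cmod z)%:C.
Proof. by rewrite cmodE normc_def. Qed.

Lemma cmod_ge0 z : 0 <= cmod z.
Proof. by rewrite cmodE sqrtr_ge0. Qed.

Lemma cmodM z w : cmod (z * w) = cmod z * cmod w.
Proof. by apply: complexI; rewrite rmorphM /= -!norm_cmod normrM. Qed.

Lemma cmodN z : cmod (- z) = cmod z.
Proof. by apply: complexI; rewrite -!norm_cmod normrN. Qed.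

Lemma cmodV z : cmod z^-1 = (cmod z)^-1.
Proof. by apply: complexI; rewrite fmorphV /= -!norm_cmod normfV. Qed.

Lemma cmodX z n : cmod (z ^+ n) = cmod z ^+ n.
Proof. by apply: complexI; rewrite rmorphXn /= -!norm_cmod normrX. Qed.

Lemma cmodR t : cmod t%:C = `|t|.
Proof. by rewrite cmodE /= expr0n addr0 sqrtr_sqr. Qed.

Lemma cmod_nat n : cmod (n%:R : R[i]) = n%:R.
Proof. by rewrite natC cmodR normr_nat. Qed.

Lemma cmod0 : cmod (0 : R[i]) = 0.
Proof. by rewrite -[0]/(0%:C) cmodR normr0. Qed.

Lemma cmod_eq0 z : (cmod z == 0) = (z == 0).
Proof. by rewrite -(inj_eq (@complexI R)) -norm_cmod normr_eq0. Qed.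

Lemma cmod_gt0 z : (0 < cmod z) = (z != 0).
Proof. by rewrite lt_neqAle cmod_ge0 andbT eq_sym cmod_eq0. Qed.

Lemma ler_cmodD z w : cmod (z + w) <= cmod z + cmod w.
Proof. by rewrite -lecR rmorphD /= -!norm_cmod ler_normD. Qed.

Lemma ler_cmod_sum (I : Type) (r : seq I) (P : pred I) (F : I -> R[i]) :
  cmod (\sum_(i <- r | P i) F i) <= \sum_(i <- r | P i) cmod (F i).
Proof.
elim/big_rec2: _ => [|i x z _ h]; first by rewrite cmod0.
by apply: le_trans (ler_cmodD _ _) _; rewrite lerD2l.
Qed.

Lemma normr_Re_le z : `|Re z| <= cmod z.
Proof. by rewrite cmodE -sqrtr_sqr ler_wsqrtr// lerDl sqr_ge0. Qed.

Lemma normr_Im_le z : `|Im z| <= cmod z.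
Proof. by rewrite cmodE -sqrtr_sqr ler_wsqrtr// lerDr sqr_ge0. Qed.

Lemma cmod_le z : cmod z <= `|Re z| + `|Im z|.
Proof.
rewrite cmodE -[leRHS]ger0_norm ?addr_ge0// -sqrtr_sqr ler_wsqrtr//.
rewrite sqrrD !real_normK ?num_real//.
by rewrite addrAC lerDl mulrn_wge0 // mulr_ge0.
Qed.

(** Neighbourhoods in [R[i]^o] are measured by a norm with values in [R[i]]; this
    and the next lemma bring limits there back to real sequences. *)
Lemma cvg_cmodP (u : nat -> R[i]) (l : R[i]) :
  ((u : nat -> R[i]^o) @ \oo --> (l : R[i]^o)) <->
  (fun n => cmod (u n - l)) @ \oo --> (0 : R).
Proof.
have ul n : `|(l : R[i]^o) - u n| = (cmod (u n - l))%:C.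
  by rewrite -norm_cmod -[RHS]normrN opprB.
split.
  move=> /cvgrPdist_lt h; apply/cvgrPdist_lt => e e0.
  have e0' : 0 < e%:C by rewrite ltcR.
  have := h _ e0'; apply: filterS => n.
  by rewrite ul ltcR sub0r normrN ger0_norm ?cmod_ge0.
move=> /cvgrPdist_lt h; apply/cvgrPdist_lt => e e0.
have er : e = (Re e)%:C by apply: complex_eq => //; apply: ger0_Im; exact: ltW.
have e0' : 0 < Re e by move: e0; rewrite er ltcR.
have := h _ e0'; apply: filterS => n.
by rewrite ul er ltcR sub0r normrN ger0_norm ?cmod_ge0.
Qed.

Lemma cvg_complexP (u : nat -> R[i]) (l : R[i]) :
  ((u : nat -> R[i]^o) @ \oo --> (l : R[i]^o)) <->
  ((fun n => Re (u n)) @ \oo --> Re l /\ (fun n => Im (u n)) @ \oo --> Im l).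
Proof.
rewrite cvg_cmodP; split.
  move=> h; split; apply/cvgrPdist_lt => e e0;
    move/cvgrPdist_lt : h => /(_ _ e0); apply: filterS => n;
    rewrite sub0r normrN ger0_norm ?cmod_ge0//; apply: le_lt_trans;
    rewrite distrC.
    by apply: le_trans (normr_Re_le _); rewrite !cReE.
  by apply: le_trans (normr_Im_le _); rewrite !cImE.
move=> [hr hi].
have h : (fun n => `|Re (u n) - Re l| + `|Im (u n) - Im l|) @ \oo --> (0 : R).
  rewrite -[0]addr0 -{1}(@normr0 _ R) -{2}(@normr0 _ R).
  by apply: cvgD; apply: cvg_norm; apply/subr_cvg0.
apply: (@squeeze_cvgr _ _ _ _ (cst 0) _ _ _ _ (cvg_cst _) h).
apply: nearW => n; rewrite cmod_ge0/=.
by apply: le_trans (cmod_le _) _; rewrite !cReE !cImE.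
Qed.

Lemma cvg_cmod (f : nat -> R[i]) (l : R[i]) : (f : nat -> R[i]^o) @ \oo --> (l : R[i]^o) ->
  (fun n => cmod (f n)) @ \oo --> cmod l.
Proof.
move=> /cvg_cmodP h; apply/subr_cvg0/norm_cvg0P.
apply: (@squeeze_cvgr _ _ _ _ (cst 0) _ _ _ _ (cvg_cst _) h).
apply: nearW => n; rewrite normr_ge0/= ler_norml; apply/andP; split.
  rewrite lerBrDr addrC lerBlDr -[cmod (f n - l)]cmodN opprB.
  by apply: le_trans (ler_cmodD _ _); rewrite addrC subrK.
by rewrite lerBlDr; apply: le_trans (ler_cmodD _ _); rewrite subrK.
Qed.

Lemma cvg_realM (c : nat -> R) (l : R) (z : R[i]) : c @ \oo --> l ->
  ((fun n => (c n)%:C * z) : nat -> R[i]^o) @ \oo --> (l%:C * z : R[i]^o).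
Proof.
move=> cl; apply/cvg_cmodP.
have -> : (fun n => cmod ((c n)%:C * z - l%:C * z)) = (fun n => `|c n - l| * cmod z).
  by apply/funext => n; rewrite -mulrBl -rmorphB cmodM cmodR.
rewrite -(mul0r (cmod z)); apply: cvgM; last exact: cvg_cst.
by apply/norm_cvg0P/subr_cvg0.
Qed.

Lemma cvgCM (f g : nat -> R[i]) (a b : R[i]) :
  (f : nat -> R[i]^o) @ \oo --> (a : R[i]^o) ->
  (g : nat -> R[i]^o) @ \oo --> (b : R[i]^o) ->
  ((fun n => f n * g n) : nat -> R[i]^o) @ \oo --> (a * b : R[i]^o).
Proof. by move=> fa gb; exact: (@cvgM R[i]^o _ _ _ _ _ _ _ fa gb). Qed.

Lemma cvgCV (f : nat -> R[i]) (a : R[i]) : a != 0 ->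
  (f : nat -> R[i]^o) @ \oo --> (a : R[i]^o) ->
  ((fun n => (f n)^-1) : nat -> R[i]^o) @ \oo --> (a^-1 : R[i]^o).
Proof. by move=> a0 fa; exact: (@cvgV R[i]^o _ _ _ _ _ a0 fa). Qed.

Lemma cvgC_unique (u : nat -> R[i]) (l l' : R[i]) :
  (u : nat -> R[i]^o) @ \oo --> (l : R[i]^o) ->
  (u : nat -> R[i]^o) @ \oo --> (l' : R[i]^o) -> l = l'.
Proof.
by move=> h h'; exact: (@cvg_unique R[i]^o (@norm_hausdorff _ _) _ _ _ _ h h').
Qed.

Lemma cvgC_limE (u : nat -> R[i]) (l : R[i]) :
  (u : nat -> R[i]^o) @ \oo --> (l : R[i]^o) -> limn (u : nat -> R[i]^o) = l.
Proof. by move=> ul; rewrite (cvg_lim _ ul)//; exact: norm_hausdorff. Qed.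

End ComplexBasics.

(** * Exponential, logarithm and principal powers *)

Section ComplexExponential.
Variable R : realType.
Implicit Types (z w s : R[i]) (t x : R).

Lemma Re_cexp z : Re (cexp z) = expR (Re z) * cos (Im z).
Proof. by rewrite /cexp Re_mulR. Qed.

Lemma Im_cexp z : Im (cexp z) = expR (Re z) * sin (Im z).
Proof. by rewrite /cexp Im_mulR. Qed.

Lemma cexpD z w : cexp (z + w) = cexp z * cexp w.
Proof.
apply: complex_eq.
  rewrite Re_cexp Re_add Im_add Re_mul !Re_cexp !Im_cexp expRD cosD; ring.
rewrite Im_cexp Re_add Im_add Im_mul !Re_cexp !Im_cexp expRD sinD; ring.
Qed.

Lemma cexp0 : cexp 0 = 1 :> R[i].
Proof. by apply: complex_eq; rewrite ?Re_cexp ?Im_cexp /= expR0 ?cos0 ?sin0 mul1r. Qed.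

Lemma cexp_real t : cexp t%:C = (expR t)%:C.
Proof.
by apply: complex_eq; rewrite ?Re_cexp ?Im_cexp /= ?cos0 ?sin0 ?mulr1 ?mulr0.
Qed.

Lemma cmod_cexp z : cmod (cexp z) = expR (Re z).
Proof.
rewrite cmodM cmodR ger0_norm ?expR_ge0// cmodE /= cos2Dsin2 sqrtr1.
by rewrite mulr1.
Qed.

Lemma cexp_neq0 z : cexp z != 0.
Proof. by rewrite -cmod_gt0 cmod_cexp expR_gt0. Qed.

Lemma cexpN z : cexp (- z) = (cexp z)^-1.
Proof.
apply: (mulfI (cexp_neq0 z)).
by rewrite divff ?cexp_neq0// -cexpD subrr cexp0.
Qed.

Lemma cexpMn z n : cexp (z * n%:R) = cexp z ^+ n.
Proof.
elim: n => [|n IH]; first by rewrite mulr0 cexp0 expr0.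
by rewrite -natr1 mulrDr mulr1 cexpD IH exprSr.
Qed.

Lemma clog_pos t : 0 < t -> clog t%:C = (ln t)%:C.
Proof.
move=> t0; apply: complex_eq => /=; first by rewrite cmodR gtr0_norm.
by rewrite /carg /= lexx cmodR gtr0_norm// divff ?gt_eqF// acos1.
Qed.

Lemma cpow_neq0 s w : s != 0 -> cpow s w = cexp (w * clog s).
Proof. by rewrite /cpow => /negPf->. Qed.

Lemma cpow_pos t w : 0 < t -> cpow t%:C w = cexp (w * (ln t)%:C).
Proof.
move=> t0; rewrite cpow_neq0 ?clog_pos//.
by rewrite -cmod_gt0 cmodR normr_gt0 gt_eqF.
Qed.

Lemma cmod_cpow_pos t w : 0 < t -> cmod (cpow t%:C w) = t `^ Re w.
Proof.
move=> t0; rewrite cpow_pos// cmod_cexp [_ * _%:C]mulrC Re_mulR mulrC.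
by rewrite /powR gt_eqF.
Qed.

Lemma cpowD s w1 w2 : s != 0 -> cpow s (w1 + w2) = cpow s w1 * cpow s w2.
Proof. by move=> s0; rewrite !cpow_neq0// mulrDl cexpD. Qed.

Lemma cpowN s w : s != 0 -> cpow s (- w) = (cpow s w)^-1.
Proof. by move=> s0; rewrite !cpow_neq0// mulNr cexpN. Qed.

Lemma cpowMn s w n : s != 0 -> cpow s (w * n%:R) = cpow s w ^+ n.
Proof. by move=> s0; rewrite !cpow_neq0// mulrAC cexpMn. Qed.

Lemma cpow_unit s w : s != 0 -> cpow s w != 0.
Proof. by move=> s0; rewrite cpow_neq0// cexp_neq0. Qed.

Lemma realC_neq0 t : 0 < t -> t%:C != 0 :> R[i].
Proof. by move=> t0; rewrite -cmod_gt0 cmodR normr_gt0 gt_eqF. Qed.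

Lemma cpow1_pos t : 0 < t -> cpow t%:C 1 = t%:C.
Proof.
move=> t0; rewrite cpow_pos// mul1r.
by apply: complex_eq; rewrite ?Re_cexp ?Im_cexp /= lnK ?posrE// ?cos0 ?sin0 ?mulr1 ?mulr0.
Qed.

Lemma cpow_posM t x w : 0 < t -> 0 < x ->
  cpow (t * x)%:C w = cpow t%:C w * cpow x%:C w.
Proof.
move=> t0 x0; rewrite !cpow_pos ?mulr_gt0// lnM ?posrE// rmorphD /=.
by rewrite mulrDr cexpD.
Qed.

Lemma Re_gt0_neq0 s : 0 < Re s -> s != 0.
Proof. by move=> s0; apply/eqP => h; rewrite h /= ltxx in s0. Qed.

Lemma cmod_Re s : 0 < Re s ->
  cmod s = Re s * Num.sqrt (1 + (Im s / Re s) ^+ 2).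
Proof.
move=> s0; rewrite cmodE -{2}[Re s]gtr0_norm// -sqrtr_sqr -sqrtrM ?sqr_ge0//.
by congr Num.sqrt; field; rewrite gt_eqF.
Qed.

Lemma cos_arg s : 0 < Re s -> Re s / cmod s = cos (atan (Im s / Re s)).
Proof.
move=> s0; rewrite cos_atan cmod_Re// invfM mulrA divff ?mul1r//.
by rewrite gt_eqF.
Qed.

(** The arctangent form of the argument, unlike the one by a signed [acos], can
    be differentiated across the real axis. *)
Lemma clog_Re_gt0 s : 0 < Re s ->
  clog s = ln (cmod s) +i* atan (Im s / Re s).
Proof.
move=> s0; rewrite /clog /carg cos_arg//; congr (_ +i* _).
have h1 := atan_gtNpi2 (Im s / Re s); have h2 := atan_ltpi2 (Im s / Re s).
have hp := pi_gt0 R.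
case: ifPn => hi.
  have h0 : 0 <= atan (Im s / Re s).
    by rewrite -atan0; apply: le_atan; rewrite divr_ge0// ltW.
  by rewrite cosK// in_itv /= h0 /=; lra.
have h0 : atan (Im s / Re s) <= 0.
  rewrite -atan0; apply: le_atan; rewrite mulr_le0_ge0 ?invr_ge0 ?ltW//.
  by rewrite ltNge.
by rewrite cosKN ?opprK// h0 andbT; lra.
Qed.

Lemma clogMr t s : 0 < t -> 0 < Re s -> clog (t%:C * s) = (ln t)%:C + clog s.
Proof.
move=> t0 s0.
have ts0 : 0 < Re (t%:C * s) by rewrite Re_mulR mulr_gt0.
rewrite !clog_Re_gt0// Re_mulR Im_mulR -mulf_div divff ?mul1r ?gt_eqF//.
by apply: complex_eq => //=; rewrite ?add0r// cmodM cmodR gtr0_norm// lnM ?posrE// cmod_gt0 Re_gt0_neq0.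
Qed.

Lemma cpowMr t s w : 0 < t -> 0 < Re s ->
  cpow (t%:C * s) w = cpow t%:C w * cpow s w.
Proof.
move=> t0 s0; rewrite cpow_pos// !cpow_neq0 ?clogMr// ?mulrDr ?cexpD//.
  exact: Re_gt0_neq0.
by apply: Re_gt0_neq0; rewrite Re_mulR mulr_gt0.
Qed.

End ComplexExponential.

(** * Derivatives of complex functions of a real variable *)

Section ComplexDerivative.
Variable R : realType.
Implicit Types (z w s : R[i]) (t x : R) (f g u : R -> R[i]).

(** Componentwise, to match the componentwise integral; it also gives continuity,
    hence measurability, of both components. *)
Definition is_cderive f t (l : R[i]) : Prop :=
  is_derive t (1 : R) (fun x : R => Re (f x)) (Re l) /\
  is_derive t (1 : R) (fun x : R => Im (f x)) (Im l).

Lemma cderive_cst z t : is_cderive (fun=> z) t 0.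
Proof. by split; exact: is_derive_cst. Qed.

Lemma cderiveD f g t a b : is_cderive f t a -> is_cderive g t b ->
  is_cderive (fun x => f x + g x) t (a + b).
Proof.
move=> [f1 f2] [g1 g2]; split.
  under eq_fun do rewrite Re_add; rewrite Re_add; exact: is_deriveD.
under eq_fun do rewrite Im_add; rewrite Im_add; exact: is_deriveD.
Qed.

Lemma cderiveM f g t a b : is_cderive f t a -> is_cderive g t b ->
  is_cderive (fun x => f x * g x) t (a * g t + f t * b).
Proof.
move=> [f1 f2] [g1 g2]; split.
  under eq_fun do rewrite Re_mul.
  apply: (@is_derive_eq _ _ _ _ _ _ _ _ (is_deriveB (is_deriveM f1 g1) (is_deriveM f2 g2))).
  rewrite /GRing.scale /= !cReE; ring.
under eq_fun do rewrite Im_mul.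
apply: (@is_derive_eq _ _ _ _ _ _ _ _ (is_deriveD (is_deriveM f1 g2) (is_deriveM f2 g1))).
rewrite /GRing.scale /= !cImE; ring.
Qed.

Lemma cderive_cexp u t a : is_cderive u t a ->
  is_cderive (fun x => cexp (u x)) t (a * cexp (u t)).
Proof.
move=> [u1 u2].
have e : is_derive t (1 : R) (fun x => expR (Re (u x))) (expR (Re (u t)) * Re a).
  exact: (@is_derive1_comp _ expR).
have c : is_derive t (1 : R) (fun x => cos (Im (u x))) (- sin (Im (u t)) * Im a).
  exact: (@is_derive1_comp _ cos).
have s : is_derive t (1 : R) (fun x => sin (Im (u x))) (cos (Im (u t)) * Im a).
  exact: (@is_derive1_comp _ sin).
split.
  under eq_fun do rewrite Re_cexp.
  apply: (@is_derive_eq _ _ _ _ _ _ _ _ (is_deriveM e c)).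
  rewrite /GRing.scale /= Re_mul Re_cexp Im_cexp; ring.
under eq_fun do rewrite Im_cexp.
apply: (@is_derive_eq _ _ _ _ _ _ _ _ (is_deriveM e s)).
rewrite /GRing.scale /= Im_mul Re_cexp Im_cexp; ring.
Qed.

Lemma cderive_realC (h : R -> R) t d : is_derive t (1 : R) h d ->
  is_cderive (fun x => (h x)%:C) t d%:C.
Proof. by move=> hd; split => //=; exact: is_derive_cst. Qed.

Lemma cderiveZ z f t a : is_cderive f t a -> is_cderive (fun x => z * f x) t (z * a).
Proof.
move=> fa; have := cderiveM (cderive_cst z t) fa.
by rewrite mul0r add0r.
Qed.

Lemma cderive_cpow z t : 0 < t ->
  is_cderive (fun x => cexp (z * (ln x)%:C)) t (z * cexp ((z - 1) * (ln t)%:C)).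
Proof.
move=> t0.
have := cderive_cexp (cderiveZ z (cderive_realC (is_derive1_ln t0))).
congr is_cderive; rewrite -mulrA; congr (_ * _).
rewrite mulrBl mul1r cexpD mulrC cexpN; congr (_ * _).
have := cpow1_pos t0; rewrite cpow_pos// mul1r => ->.
by rewrite fmorphV.
Qed.

End ComplexDerivative.

(** * Integrals over open sets exhausted by segments *)

Section RealIntegration.
Variable R : realType.
Local Notation mu := (@lebesgue_measure R).
Implicit Types (D : set R) (f F g : R -> R) (t : R).

Lemma is_derive_continuous F t d : is_derive t (1 : R) F d -> {for t, continuous F}.
Proof.
move=> h; apply: differentiable_continuous; apply/derivable1_diffP.
exact: ex_derive.
Qed.

Lemma FTC_segment f F (a b : R) : a < b ->
  (forall t, a <= t <= b -> is_derive t (1 : R) F (f t)) ->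
  (forall t, a <= t <= b -> {for t, continuous f}) ->
  (\int[mu]_(t in `[a, b]) (f t)%:E = (F b)%:E - (F a)%:E)%E.
Proof.
move=> ab dF cf.
have cF t : a <= t <= b -> F x @[x --> t] --> F t.
  by move=> /dF /is_derive_continuous.
apply: continuous_FTC2 => //.
- apply: continuous_in_subspaceT => t /set_mem /=; rewrite in_itv /= => h.
  exact: cf.
- split.
  + move=> t; rewrite in_itv /= => /andP[h1 h2].
    by have := dF t; rewrite !ltW// => /(_ isT) h; exact: ex_derive.
  + by apply: cvg_at_right_filter; apply: cF; rewrite lexx ltW.
  + by apply: cvg_at_left_filter; apply: cF; rewrite lexx ltW.
- move=> t; rewrite in_itv /= => /andP[h1 h2].
  have := dF t; rewrite !ltW// => /(_ isT) h.
  by rewrite derive1E; exact: derive_val.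
Qed.

Lemma measurable_derivable D F (d : R -> R) : open D ->
  (forall t, D t -> is_derive t (1 : R) F (d t)) -> measurable_fun D F.
Proof.
move=> oD dF; apply: open_continuous_measurable_fun => // t /set_mem Dt.
exact: is_derive_continuous (dF t Dt).
Qed.

(** Dominated convergence for the restrictions of [f] to the segments. *)
Lemma cvg_integral_exhaust D f (a b : nat -> R) : measurable D ->
  mu.-integrable D (EFin \o f) ->
  (forall n, `[a n, b n] `<=` D) ->
  (forall t, D t -> \forall n \near \oo, a n <= t <= b n) ->
  (fun n => \int[mu]_(t in `[a n, b n]) (f t)%:E)%E @ \oo -->
    (\int[mu]_(t in D) (f t)%:E)%E.
Proof.
move=> mD fi sD ex.
have /measurable_EFinP mf := measurable_int _ fi.
have h1 n : measurable_fun D (EFin \o (f \_ `[a n, b n])).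
  apply/measurable_EFinP/(@measurable_restrict _ _ _ _ _ D) => //.
  by apply: measurable_funS mf => //; exact: subIsetl.
have h2 : {ae mu, forall t, D t ->
    (fun n => (EFin \o (f \_ `[a n, b n])) t) @ \oo --> (f t)%:E}.
  apply: aeW => t Dt; apply: cvg_near_cst.
  have := ex t Dt; apply: filterS => n h.
  by rewrite /= /patch mem_set//= in_itv.
have h3 : {ae mu, forall t n, D t ->
    (`|(EFin \o (f \_ `[a n, b n])) t| <= `|f t|%:E)%E}.
  apply: aeW => t n Dt /=.
  by rewrite lee_fin /patch; case: ifP => // _; rewrite normr0.
have [_ _] := @dominated_convergence _ _ R mu D mD _ (EFin \o f) _ h1 (measurable_int _ fi) h2
  (integrable_norm fi) h3.
have -> // : (fun n => \int[mu]_(t in `[a n, b n]) (f t)%:E)%E =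
  (fun n => \int[mu]_(t in D) (EFin \o (f \_ `[a n, b n])) t)%E.
apply/funext => n /=.
rewrite -{1}(setIidr (sD n)) integral_mkcondr; apply: eq_integral => t _ /=.
by rewrite /patch; case: ifP.
Qed.

(** The segment version passes to the limit: [f] may be unbounded at the ends of
    [D], and [D] may be unbounded. *)
Lemma FTC_exhaust D f F (a b : nat -> R) (A B : R) : measurable D ->
  mu.-integrable D (EFin \o f) ->
  (forall n, a n < b n) ->
  (forall n, `[a n, b n] `<=` D) ->
  (forall t, D t -> \forall n \near \oo, a n <= t <= b n) ->
  (forall t, D t -> is_derive t (1 : R) F (f t)) ->
  (forall t, D t -> {for t, continuous f}) ->
  (fun n => F (a n)) @ \oo --> A -> (fun n => F (b n)) @ \oo --> B ->
  \int[mu]_(t in D) f t = B - A.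
Proof.
move=> mD fi ab sD ex dF cf FA FB.
have := cvg_integral_exhaust mD fi sD ex.
have -> : (fun n => \int[mu]_(t in `[a n, b n]) (f t)%:E)%E =
          (fun n => (F (b n) - F (a n))%:E).
  apply/funext => n; rewrite EFinB; apply: FTC_segment => // t abt.
    by apply: dF; apply: (sD n); rewrite /= in_itv.
  by apply: cf; apply: (sD n); rewrite /= in_itv.
move=> h.
have h2 : (fun n => (F (b n) - F (a n))%:E) @ \oo --> (B - A)%:E.
  by apply: cvg_EFin; [exact: nearW|exact: cvgB].
by rewrite /Rintegral (cvg_unique _ h h2).
Qed.

(** Fatou's lemma for the restrictions of [f] to the segments, whose integrals
    are the increments of the primitive. *)
Lemma integrable_bounded_primitive D f F (a b : nat -> R) (M : R) : open D ->
  (forall t, D t -> 0 <= f t) ->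
  (forall n, a n < b n) ->
  (forall n, `[a n, b n] `<=` D) ->
  (forall t, D t -> \forall n \near \oo, a n <= t <= b n) ->
  (forall t, D t -> is_derive t (1 : R) F (f t)) ->
  (forall t, D t -> {for t, continuous f}) ->
  (forall n, F (b n) - F (a n) <= M) ->
  mu.-integrable D (EFin \o f).
Proof.
move=> oD f0 ab sD ex dF cf FM.
have mD : measurable D by exact: open_measurable.
have mf : measurable_fun D f.
  by apply: open_continuous_measurable_fun => // t /set_mem; exact: cf.
apply/integrableP; split; first exact/measurable_EFinP.
have : (\int[mu]_(t in D) (f t)%:E <= M%:E)%E.
  have := @fatou _ _ R mu D mD (fun n => EFin \o (f \_ `[a n, b n])).
  have -> : (\int[mu]_(t in D) limn_einf ((fun n => EFin \o (f \_ `[a n, b n]))^~ t)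
     = \int[mu]_(t in D) (f t)%:E)%E.
    apply: eq_integral => t /set_mem Dt.
    apply: (cvg_limn_einf_sup _).1; apply: cvg_near_cst.
    have := ex t Dt; apply: filterS => n h.
    by rewrite /= /patch mem_set//= in_itv.
  move=> h; apply: (le_trans (h _ _)).
  - move=> n; apply/measurable_EFinP.
    apply/(@measurable_restrict _ _ _ _ _ D) => //.
    by apply: measurable_funS mf => //; exact: subIsetl.
  - by move=> n t Dt; rewrite lee_fin /patch; case: ifP => // _; exact: f0.
  - rewrite limn_einf_lim; apply: lime_le; first exact: is_cvg_einfs.
    apply: nearW => n; apply: (@le_trans _ _
        (\int[mu]_(t in D) ((f \_ `[a n, b n]) t)%:E)%E).
      by apply: ereal_inf_lbound; exists n => //=.
    have -> : (\int[mu]_(t in D) ((f \_ `[a n, b n]) t)%:E =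
               \int[mu]_(t in `[a n, b n]) (f t)%:E)%E.
      rewrite -(setIidr (sD n)) integral_mkcondr; apply: eq_integral => t _ /=.
      by rewrite setIidr// /patch; case: ifP.
    have -> : (\int[mu]_(t in `[a n, b n]) (f t)%:E = (F (b n))%:E - (F (a n))%:E)%E.
      apply: FTC_segment => // t abt; last first.
        by apply: cf; apply: (sD n); rewrite /= in_itv.
      by apply: dF; apply: (sD n); rewrite /= in_itv.
    by rewrite -EFinB lee_fin.
move=> h; have -> : (\int[mu]_(t in D) `|(EFin \o f) t| =
                     \int[mu]_(t in D) (f t)%:E)%E.
  by apply: eq_integral => t /set_mem Dt /=; rewrite ger0_norm ?f0.
exact: le_lt_trans h (ltry M).
Qed.

Lemma real_integrableD D f g : measurable D -> mu.-integrable D (EFin \o f) ->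
  mu.-integrable D (EFin \o g) -> mu.-integrable D (EFin \o (fun t => f t + g t)).
Proof.
move=> mD fi gi.
have -> : EFin \o (fun t => f t + g t) = (EFin \o f \+ (EFin \o g))%E by [].
exact: integrableD.
Qed.

Lemma real_integrableZ D f (c : R) : measurable D ->
  mu.-integrable D (EFin \o f) -> mu.-integrable D (EFin \o (fun t => c * f t)).
Proof.
move=> mD fi.
have -> : EFin \o (fun t => c * f t) = (fun t => c%:E * (EFin \o f) t)%E by [].
exact: integrableZl.
Qed.

Lemma real_integrableB D f g : measurable D -> mu.-integrable D (EFin \o f) ->
  mu.-integrable D (EFin \o g) -> mu.-integrable D (EFin \o (fun t => f t - g t)).
Proof.
move=> mD fi gi.
have -> : EFin \o (fun t => f t - g t) = (EFin \o f \- (EFin \o g))%E by [].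
exact: integrableB.
Qed.

Lemma real_le_integrable D f g : measurable D -> measurable_fun D f ->
  mu.-integrable D (EFin \o g) -> (forall t, D t -> `|f t| <= g t) ->
  mu.-integrable D (EFin \o f).
Proof.
move=> mD mf gi fg; apply: le_integrable gi => //; first exact/measurable_EFinP.
by move=> t Dt; rewrite /= lee_fin; apply: le_trans (ler_norm _); exact: fg.
Qed.

(** The half-line is exhausted by the segments [1/(n+1), n+2]. *)
Lemma exhaust_itv0y t : 0 < t ->
  \forall n \near \oo, n.+1%:R^-1 <= t <= n.+2%:R.
Proof.
move=> t0; near=> n; apply/andP; split.
  rewrite -[leRHS]invrK lef_pV2 ?posrE ?invr_gt0//.
  by apply: le_trans (_ : n%:R <= _); [near: n; exact: nbhs_infty_ger|rewrite ler_nat].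
by apply: le_trans (_ : n%:R <= _); [near: n; exact: nbhs_infty_ger|rewrite ler_nat ltnW].
Unshelve. all: end_near. Qed.

Lemma sub_exhaust_itv0y n : `[n.+1%:R^-1, n.+2%:R] `<=` (`]0, +oo[ : set R).
Proof.
move=> t /=; rewrite !in_itv/= andbT => /andP[h _].
by apply: lt_le_trans h; rewrite invr_gt0.
Qed.

Lemma lt_exhaust_itv0y n : n.+1%:R^-1 < n.+2%:R :> R.
Proof. by apply: (@le_lt_trans _ _ 1); rewrite ?invf_le1 ?ler1n// ltr1n. Qed.

End RealIntegration.

(** * Componentwise integration of complex functions *)

Section ComplexIntegration.
Variable R : realType.
Local Notation mu := (@lebesgue_measure R).
Implicit Types (D : set R) (f F : R -> R[i]) (t : R).

Definition cmeasurable D f :=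
  measurable_fun D (fun t => Re (f t)) /\ measurable_fun D (fun t => Im (f t)).

Lemma cintegrableP D f : cintegrable D f <->
  mu.-integrable D (EFin \o (fun t => Re (f t))) /\
  mu.-integrable D (EFin \o (fun t => Im (f t))).
Proof. by []. Qed.

Lemma cmeasurable_cmod D f : cmeasurable D f ->
  measurable_fun D (fun t => cmod (f t)).
Proof.
move=> [h1 h2]; under eq_fun do rewrite cmodE.
apply: measurableT_comp; first by apply: continuous_measurable_fun; exact: sqrt_continuous.
by apply: measurable_funD; exact: measurable_funX.
Qed.

Lemma cintegrable_cmeasurable D f : cintegrable D f -> cmeasurable D f.
Proof.
by move=> [/measurable_int/measurable_EFinP h1 /measurable_int/measurable_EFinP h2].
Qed.

Lemma cmeasurable_derivable D f d : open D ->
  (forall t, D t -> is_cderive f t (d t)) -> cmeasurable D f.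
Proof.
move=> oD h; split; apply: measurable_derivable oD _ => t Dt.
  exact: (h t Dt).1.
exact: (h t Dt).2.
Qed.

Lemma cintegrable_le D f (g : R -> R) : measurable D -> cmeasurable D f ->
  mu.-integrable D (EFin \o g) -> (forall t, D t -> cmod (f t) <= g t) ->
  cintegrable D f.
Proof.
move=> mD [m1 m2] gi fg.
split; apply: (real_le_integrable mD _ gi) => // t Dt.
  exact: le_trans (normr_Re_le _) (fg t Dt).
exact: le_trans (normr_Im_le _) (fg t Dt).
Qed.

Lemma integrable_cmod D f : measurable D -> cintegrable D f ->
  mu.-integrable D (EFin \o (fun t => cmod (f t))).
Proof.
move=> mD fi; have mf := cmeasurable_cmod (cintegrable_cmeasurable fi).
move/cintegrableP : fi => [fr fi].
have h : mu.-integrable D (EFin \o (fun t => `|Re (f t)| + `|Im (f t)|)).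
  by apply: real_integrableD => //; exact: integrable_norm.
apply: (real_le_integrable mD mf h) => t Dt.
by rewrite ger0_norm ?cmod_ge0//; exact: cmod_le.
Qed.

Lemma cintegrableZ D f z : measurable D -> cintegrable D f ->
  cintegrable D (fun t => z * f t).
Proof.
move=> mD /cintegrableP[h1 h2]; apply/cintegrableP; split.
  under [X in EFin \o X]eq_fun do rewrite Re_mul.
  by apply: real_integrableB => //; exact: real_integrableZ.
under [X in EFin \o X]eq_fun do rewrite Im_mul.
by apply: real_integrableD => //; exact: real_integrableZ.
Qed.

Lemma cintegrableD D f F : measurable D -> cintegrable D f -> cintegrable D F ->
  cintegrable D (fun t => f t + F t).
Proof.
move=> mD /cintegrableP[h1 h2] /cintegrableP[h3 h4]; apply/cintegrableP; split.
  under [X in EFin \o X]eq_fun do rewrite Re_add; exact: real_integrableD.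
under [X in EFin \o X]eq_fun do rewrite Im_add; exact: real_integrableD.
Qed.

Lemma cintegralZ D f z : measurable D -> cintegrable D f ->
  cintegral D (fun t => z * f t) = z * cintegral D f.
Proof.
move=> mD /cintegrableP[h1 h2].
apply: complex_eq; rewrite /cintegral ?Re_mul ?Im_mul /=.
  under eq_Rintegral do rewrite Re_mul.
  by rewrite RintegralB// ?RintegralZl//; exact: real_integrableZ.
under eq_Rintegral do rewrite Im_mul.
by rewrite RintegralD// ?RintegralZl//; exact: real_integrableZ.
Qed.

Lemma cintegralD D f F : measurable D -> cintegrable D f -> cintegrable D F ->
  cintegral D (fun t => f t + F t) = cintegral D f + cintegral D F.
Proof.
move=> mD /cintegrableP[h1 h2] /cintegrableP[h3 h4].
apply: complex_eq; rewrite /cintegral ?Re_add ?Im_add /=.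
  by under eq_Rintegral do rewrite Re_add; rewrite RintegralD.
by under eq_Rintegral do rewrite Im_add; rewrite RintegralD.
Qed.

Lemma eq_cintegral D f F : {in D, f =1 F} -> cintegral D f = cintegral D F.
Proof.
by move=> h; congr (_ +i* _); apply: eq_Rintegral => t Dt; rewrite h.
Qed.

Lemma eq_cintegrable D f F : measurable D -> {in D, f =1 F} ->
  cintegrable D f -> cintegrable D F.
Proof.
move=> mD h [h1 h2]; split.
  by apply: eq_integrable h1 => // t Dt; rewrite h.
by apply: eq_integrable h2 => // t Dt; rewrite h.
Qed.

Lemma cintegrable0 D : measurable D -> cintegrable D (fun=> 0).
Proof. by move=> mD; split; exact: integrable0. Qed.

Lemma cintegrable_sum D (g : nat -> R -> R[i]) n : measurable D ->
  (forall k, cintegrable D (g k)) ->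
  cintegrable D (fun t => \sum_(0 <= k < n) g k t) /\
  cintegral D (fun t => \sum_(0 <= k < n) g k t) =
  \sum_(0 <= k < n) cintegral D (g k).
Proof.
move=> mD gi; elim: n => [|n [IH1 IH2]].
  split.
    by apply: eq_cintegrable (cintegrable0 mD) => // t _; rewrite big_geq.
  rewrite big_geq// -[RHS](mul0r (cintegral D (fun=> 0))) -cintegralZ//.
    by apply: eq_cintegral => t _; rewrite big_geq// mul0r.
  exact: cintegrable0.
split.
  apply: eq_cintegrable (cintegrableD mD IH1 (gi n)) => // t _.
  by rewrite big_nat_recr.
rewrite big_nat_recr//= -IH2 -cintegralD//.
by apply: eq_cintegral => t _; rewrite big_nat_recr.
Qed.

Lemma cdominated_convergence D (f_ : nat -> R -> R[i]) f (g : R -> R) :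
  measurable D -> (forall n, cmeasurable D (f_ n)) -> cmeasurable D f ->
  (forall t, D t -> (f_ ^~ t : nat -> R[i]^o) @ \oo --> (f t : R[i]^o)) ->
  mu.-integrable D (EFin \o g) ->
  (forall n t, D t -> cmod (f_ n t) <= g t) ->
  cintegrable D f /\
  ((fun n => cintegral D (f_ n)) : nat -> R[i]^o) @ \oo --> (cintegral D f : R[i]^o).
Proof.
move=> mD mf_ mf ff gi fg.
have hr : {ae mu, forall t, D t ->
    (fun n => (Re (f_ n t))%:E) @ \oo --> (Re (f t))%:E}.
  apply: aeW => t Dt; apply: cvg_EFin; first exact: nearW.
  exact: ((cvg_complexP _ _).1 (ff t Dt)).1.
have hi : {ae mu, forall t, D t ->
    (fun n => (Im (f_ n t))%:E) @ \oo --> (Im (f t))%:E}.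
  apply: aeW => t Dt; apply: cvg_EFin; first exact: nearW.
  exact: ((cvg_complexP _ _).1 (ff t Dt)).2.
have gr : {ae mu, forall t n, D t -> (`|(Re (f_ n t))%:E| <= (EFin \o g) t)%E}.
  apply: aeW => t n Dt; rewrite /= lee_fin.
  exact: le_trans (normr_Re_le _) (fg n t Dt).
have gi' : {ae mu, forall t n, D t -> (`|(Im (f_ n t))%:E| <= (EFin \o g) t)%E}.
  apply: aeW => t n Dt; rewrite /= lee_fin.
  exact: le_trans (normr_Im_le _) (fg n t Dt).
have [fr _ cr] := @dominated_convergence _ _ R mu D mD
  (fun n t => (Re (f_ n t))%:E) (fun t => (Re (f t))%:E) _
  (fun n => (measurable_EFinP _ _).2 (mf_ n).1)
  ((measurable_EFinP _ _).2 mf.1) hr gi gr.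
have [fi _ ci] := @dominated_convergence _ _ R mu D mD
  (fun n t => (Im (f_ n t))%:E) (fun t => (Im (f t))%:E) _
  (fun n => (measurable_EFinP _ _).2 (mf_ n).2)
  ((measurable_EFinP _ _).2 mf.2) hi gi gi'.
split; first by split.
apply/cvg_complexP; split.
  by apply: fine_cvg; rewrite fineK//; exact: integrable_fin_num.
by apply: fine_cvg; rewrite fineK//; exact: integrable_fin_num.
Qed.

(** The derivative [d] of [f] stands for continuity of both components. *)
Lemma cFTC_exhaust D f F d (a b : nat -> R) (A B : R[i]) : measurable D ->
  cintegrable D f ->
  (forall n, a n < b n) ->
  (forall n, `[a n, b n] `<=` D) ->
  (forall t, D t -> \forall n \near \oo, a n <= t <= b n) ->
  (forall t, D t -> is_cderive F t (f t)) ->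
  (forall t, D t -> is_cderive f t (d t)) ->
  ((F \o a : nat -> R[i]^o) @ \oo --> (A : R[i]^o)) ->
  ((F \o b : nat -> R[i]^o) @ \oo --> (B : R[i]^o)) ->
  cintegral D f = B - A.
Proof.
move=> mD [fr fi] ab sD ex dF df /cvg_complexP[Ar Ai] /cvg_complexP[Br Bi].
apply: complex_eq; rewrite ?Re_add ?Re_opp ?Im_add ?Im_opp.
  apply: (FTC_exhaust mD fr ab sD ex _ _ Ar Br).
    by move=> t Dt; exact: (dF t Dt).1.
  by move=> t Dt; exact: is_derive_continuous (df t Dt).1.
apply: (FTC_exhaust mD fi ab sD ex _ _ Ai Bi).
  by move=> t Dt; exact: (dF t Dt).2.
by move=> t Dt; exact: is_derive_continuous (df t Dt).2.
Qed.

End ComplexIntegration.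

(** * Differentiation under the integral sign *)

Section DerivativeUnderIntegral.
Variable R : realType.
Local Notation mu := (@lebesgue_measure R).

Lemma real_derive_under_integral (D : set R) (f df : R -> R -> R) (G : R -> R) (a : R) :
  measurable D -> (forall y, mu.-integrable D (EFin \o f y)) ->
  (forall y t, D t -> is_derive y (1 : R) (f ^~ t) (df y t)) ->
  (forall t, 0 <= G t) -> mu.-integrable D (EFin \o G) ->
  (forall y t, D t -> `|df y t| <= G t) ->
  is_derive a (1 : R) (fun y => \int[mu]_(t in D) f y t) (\int[mu]_(t in D) df a t).
Proof.
move=> mD fi fd G0 Gi dG.
have Ia : (`]a - 1, a + 1[%classic : set R) a by rewrite /= in_itv /=; lra.
have d1 y t : D t -> partial1of2 f y t = df y t.
  by move=> Dt; rewrite partial1of2E; have h := fd y t Dt; exact: derive_val.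
have d2 : forall y t, (`]a - 1, a + 1[%classic : set R) y -> D t -> derivable (f ^~ t) y 1.
  by move=> y t _ Dt; have h := fd y t Dt; exact: ex_derive.
have d3 : forall y t, (`]a - 1, a + 1[%classic : set R) y -> D t -> `|partial1of2 f y t| <= G t.
  by move=> y t _ Dt; rewrite d1//; exact: dG.
have fi' y : (`]a - 1, a + 1[%classic : set R) y -> mu.-integrable D (EFin \o f y) by [].
apply: DeriveDef.
  exact: (@derivable_under_integral R _ _ mu f D mD a _ _ Ia fi' d2 G G0 Gi d3).
rewrite -derive1E (@differentiation_under_integral R _ _ mu f D mD a _ _ Ia fi' d2 G G0 Gi d3).
by apply: eq_Rintegral => t /set_mem Dt; rewrite d1.
Qed.

Lemma cderive_under_integral (D : set R) (f df : R -> R -> R[i]) (G : R -> R) (a : R) :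
  measurable D -> (forall y, cintegrable D (f y)) ->
  (forall y t, D t -> is_cderive (f ^~ t) y (df y t)) ->
  (forall t, 0 <= G t) -> mu.-integrable D (EFin \o G) ->
  (forall y t, D t -> cmod (df y t) <= G t) ->
  is_cderive (fun y => cintegral D (f y)) a (cintegral D (df a)).
Proof.
move=> mD fi fd G0 Gi dG; split.
  apply: (@real_derive_under_integral D (fun y t => Re (f y t)) (fun y t => Re (df y t)) G) => //.
  - by move=> y; have /cintegrableP[] := fi y.
  - by move=> y t Dt; exact: (fd y t Dt).1.
  - by move=> y t Dt; exact: le_trans (normr_Re_le _) (dG y t Dt).
apply: (@real_derive_under_integral D (fun y t => Im (f y t)) (fun y t => Im (df y t)) G) => //.
- by move=> y; have /cintegrableP[] := fi y.
- by move=> y t Dt; exact: (fd y t Dt).2.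
- by move=> y t Dt; exact: le_trans (normr_Im_le _) (dG y t Dt).
Qed.

End DerivativeUnderIntegral.

(** * The kernel of the Gamma integral *)

Section GammaKernel.
Variable R : realType.
Local Notation mu := (@lebesgue_measure R).
Local Notation D0 := (`]0, +oo[%classic : set R).
Implicit Types (s z : R[i]) (t x m sigma : R).

(** For [t > 0] this is [e^(-st) t^(z-1)]: the power is written with the real
    logarithm, so that no case distinction at [t = 0] is left to differentiate.
    Its modulus is [rkern (Re s) (Re z)], see [cmod_kern]. *)
Definition kern s z t : R[i] := cexp (- s * t%:C) * cexp ((z - 1) * (ln t)%:C).
Definition rkern sigma x t : R := expR (- (sigma * t)) * expR ((x - 1) * ln t).

Lemma rkern_ge0 sigma x t : 0 <= rkern sigma x t.
Proof. by rewrite mulr_ge0 ?expR_ge0. Qed.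

Lemma cmod_kern s z t : cmod (kern s z t) = rkern (Re s) (Re z) t.
Proof.
rewrite cmodM !cmod_cexp ![_ * _%:C]mulrC !cReE /=; congr (expR _ * expR _); ring.
Qed.

Lemma kernS s z t : 0 < t -> kern s (z + 1) t = t%:C * kern s z t.
Proof.
move=> t0; rewrite /kern [RHS]mulrCA; congr (_ * _).
have <- : cexp (1 * (ln t)%:C) = t%:C by rewrite -cpow_pos// cpow1_pos.
by rewrite -cexpD -mulrDl [1 + _]addrC subrK addrK.
Qed.

Lemma cderive_kern s z t : 0 < t ->
  is_cderive (kern s z) t ((z - 1) * kern s (z - 1) t - s * kern s z t).
Proof.
move=> t0; have h1 := cderive_cexp (cderiveZ (- s) (cderive_realC (is_derive_id t 1))).
have := cderiveM h1 (cderive_cpow (z - 1) t0).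
rewrite /kern; congr is_cderive.
by rewrite -[1%:C]/(1 : R[i]) mulr1; ring.
Qed.

(** [t^(x-1) (1+t)^(-x-1)], the derivative of [(t/(1+t))^x / x]. Its primitive is
    bounded, so it is integrable, and up to a constant it dominates both
    [t^(x-1)] on bounded intervals and [t^(x-1) e^(-sigma t)] on the half-line. *)
Definition weight x t : R := expR ((x - 1) * ln t - (x + 1) * ln (1 + t)).

Lemma is_derive_weight x t : 0 < x -> 0 < t ->
  is_derive t (1 : R) (fun t => x^-1 * expR (x * (ln t - ln (1 + t)))) (weight x t).
Proof.
move=> x0 t0; have t1 : 0 < 1 + t by rewrite addr_gt0.
have h1 := is_derive1_ln t0.
have h2 : is_derive t (1 : R) (fun t => ln (1 + t)) ((1 + t)^-1).
  have hh : is_derive t (1 : R) (fun t : R => 1 + t) 1.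
    have := is_deriveD (is_derive_cst (1 : R) t (1 : R)) (is_derive_id t (1 : R)).
    by rewrite add0r.
  have := @is_derive1_comp _ (@ln R) (fun t => 1 + t) t _ _ (is_derive1_ln t1) hh.
  by rewrite mulr1.
have h3 : is_derive t (1 : R) (fun t => x * (ln t - ln (1 + t))) (x * (t^-1 - (1 + t)^-1)).
  apply: (@is_derive_eq _ _ _ _ _ _ _ _ (is_deriveZ x (is_deriveB h1 h2))).
  by rewrite /GRing.scale.
have h4 := @is_derive1_comp _ (@expR R) _ t _ _ (is_derive_expR _) h3.
apply: (@is_derive_eq _ _ _ _ _ _ _ _ (is_deriveZ x^-1 h4)).
rewrite /GRing.scale /= /weight.
have -> : (x - 1) * ln t - (x + 1) * ln (1 + t) =
   x * (ln t - ln (1 + t)) - ln t - ln (1 + t) by ring.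
rewrite !expRB !lnK ?posrE//.
by field; rewrite !gt_eqF.
Qed.

Lemma continuous_weight x t : 0 < t -> {for t, continuous (weight x)}.
Proof.
move=> t0; have t1 : 0 < 1 + t by rewrite addr_gt0.
apply: continuous_comp; last exact: continuous_expR.
apply: continuousB; apply: continuousM; try exact: cvg_cst.
  exact: continuous_ln.
apply: continuous_comp; last exact: continuous_ln.
by apply: continuousD; [exact: cvg_cst|exact: cvg_id].
Qed.

Lemma integrable_weight x : 0 < x -> mu.-integrable D0 (EFin \o weight x).
Proof.
move=> x0; apply: (@integrable_bounded_primitive _ _ _
  (fun t => x^-1 * expR (x * (ln t - ln (1 + t)))) (fun n => n.+1%:R^-1)
  (fun n => n.+2%:R) x^-1).
- exact: interval_open.
- by move=> t _; exact: expR_ge0.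
- exact: lt_exhaust_itv0y.
- exact: sub_exhaust_itv0y.
- by move=> t; rewrite /= in_itv /= andbT; exact: exhaust_itv0y.
- by move=> t; rewrite /= in_itv /= andbT; exact: is_derive_weight.
- by move=> t; rewrite /= in_itv /= andbT; exact: continuous_weight.
move=> n; rewrite -mulrBr; apply: ler_piMr; first by rewrite invr_ge0 ltW.
rewrite lerBlDr.
rewrite -[leLHS]addr0 lerD ?expR_ge0//.
rewrite -expR0 ler_expR mulr_ge0_le0 ?(ltW x0)// ltW// subr_lt0 ltr_ln ?posrE ?ltr0n//.
by rewrite ltrDr.
Qed.

(** [(1+t)^p e^(-sigma t)] is bounded: this is [ln y < y] at
    [y = sigma (1+t) / p]. *)
Lemma pow_exp_bound sigma p t : 0 < sigma -> 0 < p -> 0 < t ->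
  p * ln (1 + t) - sigma * t <= p * ln (p / sigma) + sigma.
Proof.
move=> s0 p0 t0; have t1 : 0 < 1 + t by rewrite addr_gt0.
have y0 : 0 < sigma * (1 + t) / p by rewrite divr_gt0 ?mulr_gt0.
have := ltW (ln_sublinear y0).
rewrite -(ler_pM2l p0) [p * (_ / p)]mulrC divfK ?gt_eqF//.
have -> : ln (sigma * (1 + t) / p) = ln (1 + t) - ln (p / sigma).
  rewrite -ln_div ?posrE ?divr_gt0//; congr ln; field.
  by rewrite !gt_eqF.
by rewrite mulrBr mulrDr; lra.
Qed.

Lemma rkern_weight sigma x t : 0 < sigma -> 0 < x -> 0 < t ->
  rkern sigma x t <=
  expR ((x + 1) * ln ((x + 1) / sigma) + sigma) * weight x t.
Proof.
move=> s0 x0 t0; rewrite /rkern /weight -!expRD ler_expR.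
have := @pow_exp_bound sigma (x + 1) t s0 _ t0.
by rewrite addr_gt0// => /(_ isT); lra.
Qed.

(** Makes the primitive in [Gint_parts] vanish at infinity. *)
Lemma rkern_decay sigma x t : 0 < sigma -> 0 < x -> 0 < t ->
  rkern sigma (x + 1) t <=
  expR ((x + 1) * ln ((x + 1) / sigma) + sigma) / (1 + t).
Proof.
move=> s0 x0 t0; have t1 : 0 < 1 + t by rewrite addr_gt0.
rewrite -[X in _ / X](@lnK R) ?posrE// -expRN /rkern -!expRD ler_expR.
have := @pow_exp_bound sigma (x + 1) t s0 _ t0.
rewrite addr_gt0// => /(_ isT).
have : x * ln t <= x * ln (1 + t).
  by rewrite ler_pM2l// ler_ln ?posrE// lerDr.
lra.
Qed.

Lemma measurable_D0 : measurable D0. Proof. exact: measurable_itv. Qed.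

Lemma cmeasurable_kern s z : cmeasurable D0 (kern s z).
Proof.
apply: (@cmeasurable_derivable R D0 (kern s z)); first exact: interval_open.
by move=> t; rewrite /= in_itv /= andbT; exact: cderive_kern.
Qed.

Lemma measurable_rkern sigma x : measurable_fun D0 (rkern sigma x).
Proof.
have -> : rkern sigma x = fun t => cmod (kern sigma%:C x%:C t).
  by apply/funext => t; rewrite cmod_kern.
by apply: cmeasurable_cmod; exact: cmeasurable_kern.
Qed.

Lemma integrable_rkern sigma x : 0 < sigma -> 0 < x ->
  mu.-integrable D0 (EFin \o rkern sigma x).
Proof.
move=> s0 x0; apply: (@real_le_integrable _ D0 _ (fun t => expR ((x + 1) * ln ((x + 1) / sigma) + sigma) * weight x t)).
- exact: measurable_D0.
- exact: measurable_rkern.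
- apply: real_integrableZ; first exact: measurable_D0.
  exact: integrable_weight.
- move=> t; rewrite /= in_itv /= andbT => t0.
  by rewrite ger0_norm ?rkern_ge0//; exact: rkern_weight.
Qed.

Lemma cintegrable_kern s z : 0 < Re s -> 0 < Re z -> cintegrable D0 (kern s z).
Proof.
move=> s0 z0; apply: (@cintegrable_le _ D0 _ (rkern (Re s) (Re z))).
- exact: measurable_D0.
- exact: cmeasurable_kern.
- exact: integrable_rkern.
- by move=> t _; rewrite cmod_kern.
Qed.

Definition Gint s z : R[i] := cintegral D0 (kern s z).

Lemma cvg0_powR (a : nat -> R) x : 0 < x -> (forall n, 0 < a n) ->
  a @ \oo --> (0 : R) -> (fun n => expR (x * ln (a n))) @ \oo --> (0 : R).
Proof.
move=> x0 a0 /cvgrPdist_lt h; apply/cvgrPdist_lt => e e0.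
have d0 : 0 < expR (x^-1 * ln e) by exact: expR_gt0.
have := h _ d0; apply: filterS => n.
rewrite !sub0r !normrN !gtr0_norm ?expR_gt0// => ae.
rewrite -[ltRHS](@lnK R) ?posrE// ltr_expR.
have : ln (a n) < ln (expR (x^-1 * ln e)) by rewrite ltr_ln ?posrE.
by rewrite expRK -(ltr_pM2l x0) mulrA divff ?mul1r ?gt_eqF.
Qed.

Lemma cvg_invS : (fun n => n.+1%:R^-1 : R) @ \oo --> (0 : R).
Proof. exact: cvg_harmonic. Qed.

(** The function [kern s (z + 1)] vanishes at both ends of the half-line and is a
    primitive of [z * kern s z - s * kern s (z + 1)]. *)
Lemma Gint_parts s z : 0 < Re s -> 0 < Re z ->
  s * Gint s (z + 1) = z * Gint s z.
Proof.
move=> s0 z0.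
have z1 : 0 < Re (z + 1) by rewrite cReE /= addr_gt0.
have mD := measurable_D0.
have i1 := cintegrableZ z mD (cintegrable_kern s0 z0).
have i2 := cintegrableZ (- s) mD (cintegrable_kern s0 z1).
have i3 := cintegrableD mD i1 i2.
have : cintegral D0 (fun t => z * kern s z t + - s * kern s (z + 1) t) = 0 - 0.
  apply: (@cFTC_exhaust _ D0 _ (kern s (z + 1))
     (fun t => z * ((z - 1) * kern s (z - 1) t - s * kern s z t) +
               - s * (z * kern s z t - s * kern s (z + 1) t))
     (fun n => n.+1%:R^-1) (fun n => n.+2%:R)) => //.
  - exact: lt_exhaust_itv0y.
  - exact: sub_exhaust_itv0y.
  - by move=> t; rewrite /= in_itv /= andbT; exact: exhaust_itv0y.
  - move=> t; rewrite /= in_itv /= andbT => t0.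
    have := cderive_kern s (z + 1) t0; rewrite addrK; congr is_cderive.
    by rewrite mulNr.
  - move=> t; rewrite /= in_itv /= andbT => t0.
    apply: cderiveD; apply: cderiveZ; first exact: cderive_kern.
    by have := cderive_kern s (z + 1) t0; rewrite addrK.
  - apply/cvg_cmodP; have h := cvg0_powR z0 (fun n => _) cvg_invS.
    apply: (@squeeze_cvgr _ _ _ _ (cst 0) _ _ _ _ (cvg_cst _) (h _)).
      apply: nearW => n; rewrite subr0 cmod_ge0/= cmod_kern /rkern.
      rewrite (_ : Re (z + 1) - 1 = Re z); last by rewrite cReE /= addrK.
      apply: ler_piMl; first exact: expR_ge0.
      by rewrite expR_le1 oppr_le0 mulr_ge0 ?invr_ge0 ?ltW.
    by move=> n; rewrite invr_gt0.
  - apply/cvg_cmodP.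
    pose C := expR ((Re z + 1) * ln ((Re z + 1) / Re s) + Re s).
    have h : (fun n => C * n.+3%:R^-1) @ \oo --> (0 : R).
      rewrite -(mulr0 C); apply: cvgM; first exact: cvg_cst.
      have := cvg_invS; rewrite -(cvg_shiftn 2).
      by under eq_fun do rewrite addn2.
    apply: (@squeeze_cvgr _ _ _ _ (cst 0) _ _ _ _ (cvg_cst _) h).
    apply: nearW => n; rewrite subr0 cmod_ge0/= cmod_kern cReE /=.
    by rewrite (_ : n.+3%:R = 1 + n.+2%:R)//; apply: rkern_decay.
rewrite cintegralD// !cintegralZ//; try exact: cintegrable_kern.
by rewrite subr0 mulNr => /eqP; rewrite subr_eq0 => /eqP.
Qed.

End GammaKernel.

(** * Moving the Laplace variable along a vertical line *)

Section VerticalLine.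
Variable R : realType.
Local Notation D0 := (`]0, +oo[%classic : set R).
Local Notation ic := (0 +i* 1 : R[i]).
Implicit Types (s z : R[i]) (sigma y t : R).

Lemma cderive_vline sigma y : is_cderive (fun y => sigma +i* y) y ic.
Proof. by split => /=; [exact: is_derive_cst|exact: is_derive_id]. Qed.

Lemma cderive_kern_vline sigma y z t : 0 < t ->
  is_cderive (fun y => kern (sigma +i* y) z t) y
    (- ic * kern (sigma +i* y) (z + 1) t).
Proof.
move=> t0; rewrite kernS//.
have h1 := cderive_cexp (cderiveZ (- t%:C) (cderive_vline sigma y)).
have h2 := cderiveZ (cexp ((z - 1) * (ln t)%:C)) h1.
have e : (fun y => kern (sigma +i* y) z t) =
   (fun y => cexp ((z - 1) * (ln t)%:C) * cexp (- t%:C * (sigma +i* y))).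
  apply/funext => u; rewrite /kern [LHS]mulrC; congr (_ * cexp _).
  by rewrite mulNr mulrC -mulNr.
rewrite e; move: h2; congr is_cderive.
rewrite /kern (_ : - (sigma +i* y) * t%:C = - t%:C * (sigma +i* y)); last first.
  by rewrite mulNr mulrC -mulNr.
set A := cexp (_ * (ln t)%:C); set B := cexp _; rewrite [LHS]mulrC !mulNr.
by rewrite -!mulrA [ic * (t%:C * _)]mulrCA.
Qed.

Lemma ln_cmod_vline sigma y : 0 < sigma ->
  ln (cmod (sigma +i* y)) = 2^-1 * ln (sigma ^+ 2 + y ^+ 2).
Proof.
move=> s0; rewrite cmodE /= -powR12_sqrt ?ln_powR//.
by rewrite addr_ge0 ?sqr_ge0.
Qed.

Lemma cderive_clog_vline sigma y : 0 < sigma ->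
  is_cderive (fun y => clog (sigma +i* y)) y (ic / (sigma +i* y)).
Proof.
move=> s0; have n0 u : 0 < sigma ^+ 2 + u ^+ 2.
  by rewrite ltr_wpDr ?sqr_ge0 ?exprn_gt0.
have e u : clog (sigma +i* u) =
    2^-1 * ln (sigma ^+ 2 + u ^+ 2) +i* atan (sigma^-1 * u).
  by rewrite clog_Re_gt0//= ln_cmod_vline// [u / _]mulrC.
have -> : (fun u => clog (sigma +i* u)) =
  (fun u => 2^-1 * ln (sigma ^+ 2 + u ^+ 2) +i* atan (sigma^-1 * u)).
  by apply/funext.
have hX : is_derive y (1 : R) (fun u : R => sigma ^+ 2 + u * u) (y + y).
  have := is_deriveD (is_derive_cst (sigma ^+ 2) y (1 : R))
    (is_deriveM (is_derive_id y (1 : R)) (is_derive_id y (1 : R))).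
  by rewrite add0r /GRing.scale /= mulr1.
split => /=.
  have h1 : is_derive (sigma ^+ 2 + y * y) 1 (@ln R) (sigma ^+ 2 + y * y)^-1.
    by apply: is_derive1_ln; rewrite -expr2.
  have h := is_deriveZ (2^-1 : R) (@is_derive1_comp _ (@ln R) _ y _ _ h1 hX).
  apply: (@is_derive_eq _ _ _ _ _ _ _ _ h).
  rewrite /GRing.scale /=; field.
  by rewrite gt_eqF.
have hY := is_deriveZ (sigma^-1) (is_derive_id y (1 : R)).
have h := @is_derive1_comp _ (@atan R) _ y _ _ (is_derive1_atan _) hY.
apply: (@is_derive_eq _ _ _ _ _ _ _ _ h).
rewrite /GRing.scale /= -[sigma^-1 *: y]/(sigma^-1 * y); field.
by rewrite !gt_eqF//= addrC -expr2 n0.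
Qed.

Lemma cderive_Gint_vline sigma y z : 0 < sigma -> 0 < Re z ->
  is_cderive (fun y => Gint (sigma +i* y) z) y (- ic * Gint (sigma +i* y) (z + 1)).
Proof.
move=> s0 z0.
have z1 : 0 < Re z + 1 by rewrite addr_gt0.
have z1' : 0 < Re (z + 1) by rewrite cReE.
have -> : - ic * Gint (sigma +i* y) (z + 1) =
    cintegral D0 (fun t => - ic * kern (sigma +i* y) (z + 1) t).
  by rewrite cintegralZ//; exact: cintegrable_kern.
apply: (@cderive_under_integral _ D0 (fun y => kern (sigma +i* y) z)
  (fun y t => - ic * kern (sigma +i* y) (z + 1) t) (rkern sigma (Re z + 1))) => //.
- by move=> u; exact: cintegrable_kern.
- by move=> u t; rewrite /= in_itv /= andbT; exact: cderive_kern_vline.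
- by move=> t; exact: rkern_ge0.
- exact: integrable_rkern.
- move=> u t _; rewrite cmodM cmodN cmod_kern cReE /=.
  by rewrite cmodE /= expr0n add0r expr1n sqrtr1 mul1r.
Qed.

(** By [Gint_parts], the derivative of [y |-> Gint (sigma + iy) z] is
    [- i z / s] times the function itself, and that of [s^z] is [i z / s] times
    [s^z]; so their product is constant on the line. *)
Lemma Gint_vline s z : 0 < Re s -> 0 < Re z ->
  Gint s z * cpow s z = Gint (Re s)%:C z * cpow (Re s)%:C z.
Proof.
move=> s0 z0.
pose sigma := Re s.
pose G y := Gint (sigma +i* y) z * cexp (z * clog (sigma +i* y)).
have dG y : is_cderive G y 0.
  have := cderiveM (cderive_Gint_vline y s0 z0)
    (cderive_cexp (cderiveZ z (cderive_clog_vline y s0))).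
  congr is_cderive.
  have n0 : sigma +i* y != 0 :> R[i] by exact: Re_gt0_neq0.
  have := @Gint_parts R (sigma +i* y) z s0 z0.
  set s1 := sigma +i* y; set g1 := Gint _ _; set g0 := Gint _ _ => hp.
  have -> : g1 = z * g0 / s1 by rewrite -hp mulrC mulKf.
  ring.
have cst_G : G (Im s) = G 0.
  apply: complex_eq.
    apply: (@is_derive_0_is_cst _ (fun y => Re (G y))) => y; exact: (dG y).1.
  apply: (@is_derive_0_is_cst _ (fun y => Im (G y))) => y; exact: (dG y).2.
move: cst_G; rewrite /G -[_ +i* 0]/(sigma%:C) /sigma.
rewrite !cpow_neq0 ?Re_gt0_neq0//.
by case: s s0 {sigma G dG}.
Qed.

End VerticalLine.

(** * Euler's integral on a bounded interval *)

Section EulerIntegral.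
Variable R : realType.
Local Notation mu := (@lebesgue_measure R).
Local Notation D0 := (`]0, +oo[%classic : set R).
Implicit Types (s z w : R[i]) (sigma t m u : R).

(** The numerator [z (z+1) ... (z+n)] of Euler's limit formula. *)
Definition rising z n : R[i] := \prod_(0 <= j < n.+1) (z + j%:R).

Lemma rising0 z : rising z 0 = z.
Proof. by rewrite /rising big_nat1 addr0. Qed.

Lemma risingS z n : rising z n.+1 = rising z n * (z + n.+1%:R).
Proof. by rewrite /rising big_nat_recr. Qed.

Lemma risingSl z n : rising z n.+1 = z * rising (z + 1) n.
Proof.
rewrite /rising big_nat_recl//= addr0; congr (_ * _).
by apply: eq_bigr => j _; rewrite -natr1 addrAC addrA.
Qed.

Lemma rising_neq0 z n : 0 < Re z -> rising z n != 0.
Proof.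
move=> z0; rewrite /rising prodf_seq_neq0; apply/allP => j _ /=.
by apply: Re_gt0_neq0; rewrite !cReE ltr_wpDr.
Qed.

Definition euler n m z t : R[i] := ((1 - t / m) ^+ n)%:C * kern 0 z t.

Lemma eulerS n m z t : 0 < t ->
  euler n.+1 m z t = euler n m z t + (- m^-1)%:C * euler n m (z + 1) t.
Proof.
move=> t0; rewrite /euler kernS// exprSr rmorphM /= rmorphB rmorphN rmorphM /=.
by rewrite rmorph1; ring.
Qed.

Lemma kern0E z t : kern 0 z t = cexp ((z - 1) * (ln t)%:C).
Proof. by rewrite /kern oppr0 mul0r cexp0 mul1r. Qed.

Lemma measurable_D0m m : measurable (`]0, m[%classic : set R).
Proof. exact: measurable_itv. Qed.

Lemma sub_D0m m : `]0, m[%classic `<=` D0.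
Proof. by move=> t /=; rewrite !in_itv /= => /andP[->]. Qed.

Lemma cintegrable_kern0 m z : 0 < Re z -> cintegrable `]0, m[ (kern 0 z).
Proof.
move=> z0.
apply: (@cintegrable_le _ `]0, m[ _ (fun t => expR ((Re z + 1) * ln (1 + m)) * weight (Re z) t)).
- exact: measurable_D0m.
- have [h1 h2] := @cmeasurable_kern R 0 z.
  by split; apply: measurable_funS (@sub_D0m m) _ => //; exact: measurable_D0.
- apply: real_integrableZ; first exact: measurable_D0m.
  apply: (@integrableS _ _ _ mu D0).
  - exact: measurable_D0.
  - exact: measurable_D0m.
  - exact: sub_D0m.
  - exact: integrable_weight.
move=> t; rewrite /= in_itv /= => /andP[t0 tm].
rewrite cmod_kern /rkern mul0r oppr0 expR0 mul1r /weight -expRD ler_expR.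
have : (Re z + 1) * ln (1 + t) <= (Re z + 1) * ln (1 + m).
  have m0 := lt_trans t0 tm.
  rewrite ler_pM2l ?addr_gt0// ler_ln ?posrE ?addr_gt0//.
  by rewrite lerD2l ltW.
lra.
Qed.

(* The open interval ]0, m[ is exhausted by the segments
   [m/(n+3), m - m/(n+3)]; the shift by 3 keeps them nonempty. *)
Section BoundedInterval.
Variable m : R.
Hypothesis m0 : 0 < m.
Let a n := m / n.+3%:R.
Let b n := m - a n.

Let a0 n : 0 < a n. Proof. by rewrite divr_gt0. Qed.

Let ab n : a n < b n.
Proof.
rewrite /b ltrBrDr -mulr2n -mulr_natr /a mulrAC -mulrA gtr_pMr//.
by rewrite ltr_pdivrMr// mul1r ltr_nat.
Qed.

Let cvg_a : a @ \oo --> (0 : R).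
Proof.
rewrite -(mulr0 m); apply: cvgM; first exact: cvg_cst.
have := @cvg_invS R; rewrite -(cvg_shiftn 2).
by under eq_fun do rewrite addn2.
Qed.

Let cvg_b : b @ \oo --> m.
Proof. by rewrite -[X in _ --> X]subr0; apply: cvgB => //; exact: cvg_cst. Qed.

Lemma integral_kern0 z : 0 < Re z ->
  cintegral `]0, m[ (kern 0 z) = cpow m%:C z / z.
Proof.
move=> z0; have zn0 := Re_gt0_neq0 z0.
pose F t := z^-1 * cexp (z * (ln t)%:C).
have dF t : 0 < t -> is_cderive F t (kern 0 z t).
  move=> t0; have := cderiveZ z^-1 (cderive_cpow z t0); congr is_cderive.
  by rewrite mulKf// kern0E.
have -> : cpow m%:C z / z = F m - 0 by rewrite subr0 cpow_pos// mulrC.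
apply: (@cFTC_exhaust _ _ _ F (fun t => (z - 1) * kern 0 (z - 1) t - 0 * kern 0 z t) a b).
- exact: measurable_D0m.
- exact: cintegrable_kern0.
- exact: ab.
- move=> n t /=; rewrite !in_itv /= => /andP[h1 h2].
  by rewrite (lt_le_trans (a0 n))//= (le_lt_trans h2)// ltrBlDr ltrDl.
- move=> t; rewrite /= in_itv /= => /andP[h1 h2].
  have mt : 0 < m - t by rewrite subr_gt0.
  have H1 : \forall n \near \oo, a n < t by exact: (cvgr_lt _ cvg_a _ h1).
  have H2 : \forall n \near \oo, a n < m - t by exact: (cvgr_lt _ cvg_a _ mt).
  near=> n; apply/andP; split; first by apply: ltW; near: n.
  by have : a n < m - t; [near: n|rewrite /b; lra].
- by move=> t; rewrite /= in_itv /= => /andP[t0 _]; exact: dF.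
- by move=> t; rewrite /= in_itv /= => /andP[t0 _]; exact: cderive_kern.
- apply/cvg_cmodP; have h := cvg0_powR z0 a0 cvg_a.
  have -> : (fun n => cmod ((F \o a) n - 0)) =
            (fun n => cmod z^-1 * expR (Re z * ln (a n))).
    apply/funext => n; rewrite subr0 /F /= cmodM cmod_cexp; congr (_ * expR _).
    by rewrite [z * _]mulrC Re_mulR mulrC.
  by rewrite -(mulr0 (cmod z^-1)); apply: cvgM => //; exact: cvg_cst.
- have [h1 h2] := dF m m0.
  apply/cvg_complexP; split.
    exact: (cvg_comp _ _ cvg_b (is_derive_continuous h1)).
  exact: (cvg_comp _ _ cvg_b (is_derive_continuous h2)).
Unshelve. all: end_near. Qed.

(** Induction on [n] through the linear relation [eulerS], without integrating by
    parts: the right-hand sides satisfy the same relation because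
    [(z + n + 1) - z = n + 1]. *)
Lemma euler_integral n z : 0 < Re z ->
  cintegrable `]0, m[ (euler n m z) /\
  cintegral `]0, m[ (euler n m z) = n`!%:R * cpow m%:C z / rising z n.
Proof.
have mD := measurable_D0m m.
elim: n z => [|n IH] z z0.
  have e : {in `]0, m[%classic, kern 0 z =1 euler 0 m z}.
    by move=> t _; rewrite /euler expr0 mul1r.
  split; first exact: (eq_cintegrable mD e (cintegrable_kern0 m z0)).
  by rewrite -(eq_cintegral e) integral_kern0// fact0 mul1r rising0.
have z1 : 0 < Re (z + 1) by rewrite cReE /= addr_gt0.
have [i1 j1] := IH z z0; have [i2 j2] := IH (z + 1) z1.
have e : {in `]0, m[%classic, (fun t => euler n m z t + (- m^-1)%:C * euler n m (z + 1) t)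
    =1 euler n.+1 m z}.
  by move=> t; rewrite inE /= in_itv /= => /andP[t0 _]; rewrite eulerS.
have i3 := cintegrableZ (- m^-1)%:C mD i2.
split; first exact: (eq_cintegrable mD e (cintegrableD mD i1 i3)).
rewrite -(eq_cintegral e) cintegralD// cintegralZ// j1 j2.
have mn0 := realC_neq0 m0.
rewrite cpowD// cpow1_pos// factS natrM.
have P1 := rising_neq0 n z0.
have zn0 := Re_gt0_neq0 z0.
have zn : z + n.+1%:R != 0 by apply: Re_gt0_neq0; rewrite !cReE ltr_wpDr.
have h : rising (z + 1) n = rising z n * (z + n.+1%:R) / z.
  by rewrite -risingS risingSl mulrC mulKf.
rewrite h risingS rmorphN fmorphV /=.
move: P1 zn0 zn mn0; rewrite -natr1.
set A := n`!%:R; set B := cpow _ _; set P := rising z n; set N := (n%:R : R[i]).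
set M := m%:C => P1 zn0 zn mn0.
field.
by rewrite P1 zn0 zn mn0.
Qed.

End BoundedInterval.

End EulerIntegral.

(** * Euler's limit formula and the Gamma integral *)

Section EulerLimit.
Variable R : realType.
Local Notation mu := (@lebesgue_measure R).
Local Notation D0 := (`]0, +oo[%classic : set R).
Implicit Types (s z w : R[i]) (sigma t m u : R).

Lemma cintegral_restrict (D E : set R) (f : R -> R[i]) : E `<=` D ->
  (forall t, D t -> ~ E t -> f t = 0) -> cintegral D f = cintegral E f.
Proof.
move=> ED f0.
have h (g : R -> R) : (forall t, D t -> ~ E t -> g t = 0) ->
    \int[mu]_(t in D) g t = \int[mu]_(t in E) g t.
  move=> g0; rewrite Rintegral_mkcond [RHS]Rintegral_mkcond; congr Rintegral.
  apply/funext => t; rewrite /patch; case: ifPn => Dt; case: ifPn => Et //.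
    apply: g0; first exact: set_mem.
    by move=> /mem_set; rewrite (negbTE Et).
  by case/negP : Dt; apply: mem_set; apply: ED; exact: set_mem.
by congr (_ +i* _); apply: h => t Dt Et; rewrite f0.
Qed.

(** Upper half of the squeeze for [(1 - u/N)^N -> e^(-u)], and the domination in
    Euler's limit. *)
Lemma one_sub_pow_le u n : u <= n.+1%:R -> (1 - u / n.+1%:R) ^+ n.+1 <= expR (- u).
Proof.
move=> un; have n0 : 0 < n.+1%:R :> R by [].
have -> : - u = - (u / n.+1%:R) * n.+1%:R by rewrite mulNr divfK ?gt_eqF.
rewrite expRM_natr lerXn2r ?nnegrE ?expR_ge0//.
  by rewrite subr_ge0 ler_pdivrMr// mul1r.
by have := expR_ge1Dx (- (u / n.+1%:R)).
Qed.

Lemma one_sub_pow_ge u n : 0 < u -> u < n.+1%:R ->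
  expR (- (u / (1 - u / n.+1%:R))) <= (1 - u / n.+1%:R) ^+ n.+1.
Proof.
move=> u0 un; have n0 : 0 < n.+1%:R :> R by [].
have v1 : 0 < 1 - u / n.+1%:R by rewrite subr_gt0 ltr_pdivrMr// mul1r.
set N := n.+1%:R in un n0 v1 *.
have nu : 0 < N - u by rewrite subr_gt0.
have -> : - (u / (1 - u / N)) = - (u / (N - u)) * N.
  by move: N un n0 v1 nu => N un n0 v1 nu; field; rewrite !gt_eqF.
rewrite expRM_natr; apply: lerXn2r; rewrite ?nnegrE ?expR_ge0 ?(ltW v1)//.
rewrite expRN -[leRHS]invrK lef_pV2 ?posrE ?expR_gt0 ?invr_gt0//.
apply: le_trans (expR_ge1Dx _).
rewrite le_eqVlt; apply/orP; left; apply/eqP.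
by move: N un n0 v1 nu => N un n0 v1 nu; field; rewrite !gt_eqF.
Qed.

Lemma cvg_one_sub_pow u : 0 < u ->
  (fun n => (Num.max 0 (1 - u / n.+1%:R)) ^+ n.+1) @ \oo --> expR (- u).
Proof.
move=> u0.
have c1 : (fun n => 1 - u / n.+1%:R : R) @ \oo --> (1 : R).
  rewrite -[X in _ --> X]subr0 -(mulr0 u); apply: cvgB; first exact: cvg_cst.
  by apply: cvgM; [exact: cvg_cst|exact: cvg_invS].
have c2 : (fun n => expR (- (u / (1 - u / n.+1%:R)))) @ \oo --> expR (- u).
  rewrite -[X in expR (- X)]divr1.
  apply: (cvg_comp _ expR); last exact: continuous_expR.
  apply: cvgN; apply: cvgM; first exact: cvg_cst.
  by apply: cvgV => //; rewrite oner_eq0.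
apply: (squeeze_cvgr _ c2 (cvg_cst _)).
near=> n; have un : u < n.+1%:R.
  apply: (@lt_le_trans _ _ n%:R); last by rewrite ler_nat.
  by near: n; exact: nbhs_infty_gtr.
rewrite max_r; last by rewrite subr_ge0 ler_pdivrMr// mul1r ltW.
by rewrite one_sub_pow_ge//= one_sub_pow_le// ltW.
Unshelve. all: end_near. Qed.

Lemma rGamma_seqE z n : rGamma_seq z n = rising z n / (n`!%:R * cpow n%:R z).
Proof. by []. Qed.

(** The maximum with 0 extends the integrand of Euler's integral by 0 to the whole
    half-line, where dominated convergence takes place. *)
Definition euler_cut sigma z n t : R[i] :=
  ((Num.max 0 (1 - sigma * t / n.+1%:R)) ^+ n.+1)%:C * kern 0 z t.

Lemma integral_euler_cut sigma z n : 0 < sigma -> 0 < Re z ->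
  cintegral D0 (euler_cut sigma z n) = (rGamma_seq z n.+1)^-1 / cpow sigma%:C z.
Proof.
move=> s0 z0; have n0 : 0 < n.+1%:R :> R by [].
have m0 : 0 < n.+1%:R / sigma by rewrite divr_gt0.
have E t : 1 - sigma * t / n.+1%:R = 1 - t / (n.+1%:R / sigma).
  by rewrite invf_div [sigma * t]mulrC mulrA.
rewrite (@cintegral_restrict _ `]0, n.+1%:R / sigma[).
- rewrite (@eq_cintegral _ _ _ (euler n.+1 (n.+1%:R / sigma) z)).
    rewrite (euler_integral m0 _ z0).2 rGamma_seqE invf_div -[RHS]mulrA -[LHS]mulrA.
    rewrite -[RHS]mulrA; congr (_ * _).
    rewrite cpow_posM ?invr_gt0// natC -[LHS]mulrA; congr (_ * _).
    rewrite [LHS]mulrC; congr (_ * _).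
    rewrite !cpow_pos ?invr_gt0// lnV ?posrE// rmorphN mulrN cexpN //.
  move=> t; rewrite inE /= in_itv /= => /andP[t0 tm].
  rewrite /euler_cut /euler E max_r// subr_ge0 ltW// ltr_pdivrMr// mul1r.
  exact: tm.
- exact: sub_D0m.
move=> t; rewrite /= !in_itv /= andbT => t0 /negP; rewrite t0 /= -leNgt => tm.
rewrite /euler_cut E max_l ?expr0n /= ?mul0r//.
by rewrite subr_le0 ler_pdivlMr// mul1r.
Qed.

Lemma kern_real sigma z t : kern sigma%:C z t = (expR (- (sigma * t)))%:C * kern 0 z t.
Proof.
rewrite /kern oppr0 mul0r cexp0 mul1r; congr (_ * _).
rewrite mulNr -rmorphM -rmorphN.
exact: cexp_real.
Qed.

(** Dominated convergence of Euler's integrals from 0 to [n/sigma]. It gives the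
    limit of the reciprocals only: that it is not 0 is proved in [Gint_neq0]. *)
Lemma cvg_rGamma_seqV sigma z : 0 < sigma -> 0 < Re z ->
  ((fun n => (rGamma_seq z n.+1)^-1) : nat -> R[i]^o) @ \oo -->
  (Gint sigma%:C z * cpow sigma%:C z : R[i]^o).
Proof.
move=> s0 z0.
have h1 n : cmeasurable D0 (euler_cut sigma z n).
  have [k1 k2] := @cmeasurable_kern R 0 z.
  have mc : measurable_fun D0
      (fun t => (Num.max 0 (1 - sigma * t / n.+1%:R)) ^+ n.+1).
    apply: measurable_funTS; apply: measurable_funX; apply: measurable_maxr => //.
    by apply: measurable_funB => //; apply: measurable_funM => //; apply: measurable_funM.
  split; rewrite /euler_cut.
    by under [X in measurable_fun _ X]eq_fun do rewrite Re_mulR; exact: measurable_funM.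
  by under [X in measurable_fun _ X]eq_fun do rewrite Im_mulR; exact: measurable_funM.
have h2 t : D0 t -> (euler_cut sigma z ^~ t : nat -> R[i]^o) @ \oo -->
    (kern sigma%:C z t : R[i]^o).
  rewrite /= in_itv /= andbT => t0.
  have c := cvg_one_sub_pow (mulr_gt0 s0 t0).
  by rewrite kern_real; exact: cvg_realM.
have h3 n t : D0 t -> cmod (euler_cut sigma z n t) <= rkern sigma (Re z) t.
  rewrite /= in_itv /= andbT => t0.
  rewrite cmodM cmod_kern cmodR ger0_norm ?exprn_ge0 ?le_max ?lexx//.
  rewrite /rkern mul0r oppr0 expR0 mul1r; apply: ler_wpM2r; first exact: expR_ge0.
  have [un|un] := leP (sigma * t) n.+1%:R.
    by rewrite max_r ?one_sub_pow_le// subr_ge0 ler_pdivrMr// mul1r.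
  rewrite max_l ?expr0n ?expR_ge0//.
  by rewrite subr_le0 ler_pdivlMr// mul1r ltW.
have [_] := cdominated_convergence (@measurable_D0 R) h1 (cmeasurable_kern _ _)
  h2 (integrable_rkern s0 z0) h3.
have -> : (fun n => cintegral D0 (euler_cut sigma z n)) =
    (fun n => (rGamma_seq z n.+1)^-1 / cpow sigma%:C z).
  by apply/funext => n; exact: integral_euler_cut.
(* multiply back by sigma^z, which came from m^z with m = (n+1)/sigma *)
have p0 := cpow_unit z (realC_neq0 s0).
move=> h.
have -> : (fun n => (rGamma_seq z n.+1)^-1) =
    (fun n => (rGamma_seq z n.+1)^-1 / cpow sigma%:C z * cpow sigma%:C z).
  by apply/funext => n; rewrite divfK.
by apply: cvgCM h _; exact: cvg_cst.
Qed.

Lemma kern1 z t : kern 1 z t = (expR (- t))%:C * kern 0 z t.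
Proof. by have := kern_real 1 z t; rewrite mul1r. Qed.

Lemma kern1_real u t : kern 1 u%:C t = (rkern 1 u t)%:C.
Proof.
have e : u%:C - 1 = (u - 1)%:C by rewrite rmorphB rmorph1.
by rewrite kern1 kern0E e -rmorphM cexp_real -rmorphM /rkern mul1r.
Qed.

Lemma segment_integral_le (p q : R) (f g : R -> R) : 0 < p ->
  mu.-integrable D0 (EFin \o f) -> (forall t, D0 t -> 0 <= f t) ->
  measurable_fun `[p, q] g ->
  (forall t, p <= t <= q -> 0 <= g t <= f t) ->
  (\int[mu]_(t in `[p, q]) (g t)%:E <= (\int[mu]_(t in D0) f t)%:E)%E.
Proof.
move=> p0 fi f0 mg gf.
have mI : measurable (`[p, q]%classic : set R) by exact: measurable_itv.
have ID : `[p, q]%classic `<=` D0.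
  by move=> t; rewrite /= !in_itv /= andbT => /andP[h _]; exact: lt_le_trans h.
have mf : measurable_fun D0 (EFin \o f) by exact: measurable_int fi.
rewrite /Rintegral fineK; last by apply: integrable_fin_num.
apply: le_trans (@ge0_subset_integral _ _ _ mu _ _ mI (@measurable_D0 R) _ mf _ ID); last first.
  by move=> t Dt; rewrite lee_fin f0.
apply: ge0_le_integral.
- exact: mI.
- by move=> t; rewrite /= in_itv /= => /gf/andP[g0 _]; rewrite lee_fin.
- exact/measurable_EFinP.
- by apply: measurable_funS mf => //; exact: measurable_D0.
- by move=> t; rewrite /= in_itv /= => /gf/andP[_ gft]; rewrite lee_fin.
Qed.

Lemma integral_segment_cst (p q c : R) : p < q ->
  (\int[mu]_(t in `[p, q]) c%:E = (c * (q - p))%:E)%E.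
Proof.
move=> pq; have h : mu `[p, q]%classic = (q - p)%:E.
  by rewrite lebesgue_measure_itv /= lte_fin pq -EFinB.
transitivity (c%:E * mu `[p, q]%classic)%E; first exact: integral_cst.
by rewrite h -EFinM.
Qed.

(** The mass of the segment [M, M+1] alone. *)
Lemma Gint_real_ge u M : 0 < u -> 0 < M ->
  expR (u * ln M - (M + 1)) <= Re (Gint 1 (u%:C + 1)).
Proof.
move=> u0 M0; have u1 : 0 < u + 1 by rewrite addr_gt0.
have M1 : M < M + 1 by rewrite ltrDl.
have -> : Re (Gint 1 (u%:C + 1)) = \int[mu]_(t in D0) rkern 1 (u + 1) t.
  by apply: eq_Rintegral => t _; rewrite -[u%:C + 1]rmorphD kern1_real.
have := @integral_segment_cst M (M + 1) (expR (u * ln M - (M + 1))) M1.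
rewrite addrAC subrr add0r mulr1 => h; rewrite -lee_fin -h.
apply: segment_integral_le => //.
- exact: integrable_rkern.
- by move=> t _; exact: rkern_ge0.
move=> t /andP[h1 h2]; rewrite expR_ge0 /rkern /= addrK mul1r addrC expRD.
rewrite ler_pM ?expR_ge0// ler_expR; first by rewrite lerN2.
rewrite ler_pM2l// ler_ln ?posrE//; exact: lt_le_trans h1.
Qed.

Lemma Gint_real_gt0 u : 0 < u -> Im (Gint 1 u%:C) = 0 /\ 0 < Re (Gint 1 u%:C).
Proof.
move=> u0; split.
  have -> : Im (Gint 1 u%:C) = \int[mu]_(t in D0) 0.
    by apply: eq_Rintegral => t _; rewrite kern1_real.
  by rewrite Rintegral_cst ?mul0r//; exact: measurable_D0.
have := @Gint_parts R 1 u%:C ltr01 u0; rewrite mul1r => h.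
have := @Gint_real_ge u 1 u0 ltr01; rewrite h Re_mulR => /(lt_le_trans (expR_gt0 _)).
by rewrite pmulr_rgt0.
Qed.

(** In the usual notation, [1/Gamma(u) <= u e^(M+1) M^(-u)]. The free parameter
    [M] replaces Stirling's formula: every later growth estimate is a choice of
    [M]. Passing through [Gamma(u+1) = u Gamma(u)] makes it valid for small [u]. *)
Lemma Gint_real_inv_le u M : 0 < u -> 0 < M ->
  (Re (Gint 1 u%:C))^-1 <= u * expR (M + 1) * expR (- (u * ln M)).
Proof.
move=> u0 M0; have [_ g0] := Gint_real_gt0 u0.
have := @Gint_real_ge u M u0 M0.
have := @Gint_parts R 1 u%:C ltr01 u0; rewrite mul1r => ->.
rewrite Re_mulR => h.
rewrite -[leRHS]invrK lef_pV2 ?posrE ?invr_gt0 ?mulr_gt0 ?expR_gt0//.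
rewrite -mulrA -expRD invfM -expRN -ler_pdivlMl ?invr_gt0//.
by rewrite invrK (le_trans _ h)// ler_expR; lra.
Qed.

End EulerLimit.

(** * The reciprocal Gamma function *)

Section ReciprocalGamma.
Variable R : realType.
Implicit Types (s z w : R[i]) (sigma t m u : R).

Lemma cmod_add_nat_le z j : 0 < Re z + j%:R ->
  cmod (z + j%:R) <=
  (Re z + j%:R) * expR (Im z ^+ 2 / (Re z + j%:R) ^+ 2 / 2).
Proof.
move=> v0; set v := Re z + j%:R in v0 *; set q := Im z ^+ 2 / v ^+ 2.
rewrite cmodE !cReE !cImE addr0 -/v.
rewrite -[leRHS]ger0_norm; last by rewrite mulr_ge0 ?expR_ge0 ?ltW.
rewrite -sqrtr_sqr ler_wsqrtr// exprMn -expRM_natr divfK//.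
apply: (@le_trans _ _ (v ^+ 2 * (1 + q))).
  by rewrite /q mulrDr mulr1 mulrCA divff ?mulr1// sqrf_eq0 gt_eqF.
by apply: ler_wpM2l; [exact: sqr_ge0|exact: expR_ge1Dx].
Qed.

(** With [z = x + iy], each factor satisfies
    [|z + j| <= (x + j) e^(y^2 / 2(x+j)^2)], and for [j >= 1] the bound
    [1/(x+j)^2 <= 1/(x+j-1) - 1/(x+j)] telescopes. *)
Lemma cmod_rising_le z n : 0 < Re z ->
  cmod (rising z n) <= cmod (rising (Re z)%:C n) *
   expR ((Im z ^+ 2 / Re z ^+ 2 + Im z ^+ 2 * ((Re z)^-1 - (Re z + n%:R)^-1)) / 2).
Proof.
move=> z0; elim: n => [|n IH].
  rewrite !rising0 cmodR gtr0_norm// addr0 subrr mulr0 addr0.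
  have := @cmod_add_nat_le z 0; rewrite !addr0; exact.
have p1 : 0 < Re z + n%:R by rewrite ltr_wpDr.
have p2 : 0 < Re z + n.+1%:R by rewrite ltr_wpDr.
rewrite !risingS !cmodM.
have e : cmod ((Re z)%:C + n.+1%:R) = Re z + n.+1%:R.
  by rewrite natC -rmorphD cmodR gtr0_norm.
apply: (le_trans (ler_pM (cmod_ge0 _) (cmod_ge0 _) IH (cmod_add_nat_le p2))).
rewrite e mulrACA; apply: ler_wpM2l; first by rewrite mulr_ge0 ?cmod_ge0 ?ltW.
rewrite -expRD ler_expR -mulrDl ler_pM2r ?invr_gt0// -addrA lerD2l.
rewrite -mulrDr; apply: ler_wpM2l; first exact: sqr_ge0.
rewrite -lerBrDl [leRHS](_ : _ = (Re z + n%:R)^-1 - (Re z + n.+1%:R)^-1); last by ring.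
move: p1 p2; rewrite -natr1 addrA; move: (Re z + n%:R) => v p1 p2.
have -> : v^-1 - (v + 1)^-1 = (v * (v + 1))^-1 by field; rewrite !gt_eqF.
rewrite lef_pV2 ?posrE ?exprn_gt0 ?mulr_gt0// expr2.
by rewrite ler_pM2r// lerDl.
Qed.

Lemma cmod_cpow_nat n z : cmod (cpow (n.+1%:R : R[i]) z) = n.+1%:R `^ Re z.
Proof. by rewrite natC cmod_cpow_pos. Qed.

(** In a sector, replacing [z] by its real part costs at most a factor exponential
    in [Re z], uniformly in [n]. *)
Lemma cmod_rGamma_seq_le z n L : 0 < Re z -> `|Im z| <= L * Re z ->
  cmod (rGamma_seq z n.+1) <=
  expR (L ^+ 2 * (1 + Re z) / 2) * cmod (rGamma_seq (Re z)%:C n.+1).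
Proof.
move=> z0 yL.
have Ly : Im z ^+ 2 <= L ^+ 2 * Re z ^+ 2.
  by rewrite -exprMn -real_normK ?num_real// lerXn2r ?nnegrE// (le_trans _ yL).
rewrite !rGamma_seqE [leRHS]mulrC !cmodM !cmodV !cmodM !cmod_cpow_nat /=.
rewrite [leRHS]mulrAC; apply: ler_wpM2r.
  by rewrite invr_ge0 mulr_ge0 ?cmod_ge0 ?powR_ge0.
apply: le_trans (cmod_rising_le n.+1 z0) _.
apply: ler_wpM2l; first exact: cmod_ge0.
rewrite ler_expR ler_pM2r ?invr_gt0// [leRHS]mulrDr mulr1; apply: lerD.
  by rewrite ler_pdivrMr// exprn_gt0.
apply: (@le_trans _ _ (Im z ^+ 2 / Re z)).
  by apply: ler_wpM2l; [exact: sqr_ge0|rewrite gerBl invr_ge0 ltW// ltr_wpDr].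
by rewrite ler_pdivrMr// -mulrA -expr2.
Qed.

Lemma cpow1l z : cpow (1 : R[i]) z = 1.
Proof. by have := @cpow_pos R 1 z ltr01; rewrite ln1 mulr0 cexp0. Qed.

Lemma rGamma_seq_neq0 z n : 0 < Re z -> rGamma_seq z n.+1 != 0.
Proof.
move=> z0; rewrite rGamma_seqE mulf_neq0 ?rising_neq0// invr_eq0 mulf_neq0//.
by rewrite cpow_unit// natC realC_neq0.
Qed.

Lemma cvg_rGamma_seqV1 z : 0 < Re z ->
  ((fun n => (rGamma_seq z n.+1)^-1) : nat -> R[i]^o) @ \oo --> (Gint 1 z : R[i]^o).
Proof.
by move=> z0; have := cvg_rGamma_seqV ltr01 z0; rewrite cpow1l mulr1.
Qed.

(** Limit of [cmod_rGamma_seq_le]. As the real Gamma integral is positive, it keeps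
    the complex one away from 0. *)
Lemma cmod_Gint_ge z L : 0 < Re z -> `|Im z| <= L * Re z ->
  Re (Gint 1 (Re z)%:C) <= expR (L ^+ 2 * (1 + Re z) / 2) * cmod (Gint 1 z).
Proof.
move=> z0 yL; have [g1 g2] := Gint_real_gt0 z0.
have -> : Re (Gint 1 (Re z)%:C) = cmod (Gint 1 (Re z)%:C).
  by rewrite cmodE g1 expr0n addr0 sqrtr_sqr gtr0_norm.
have h1 := cvg_cmod (cvg_rGamma_seqV1 (z := (Re z)%:C) z0).
have h2 := cvg_cmod (cvg_rGamma_seqV1 z0).
apply: (ler_cvg_to h1 (cvgM (cvg_cst (expR (L ^+ 2 * (1 + Re z) / 2))) h2)).
apply: nearW => n; rewrite /= !cmodV ler_pdivlMr; last first.
  by rewrite cmod_gt0 rGamma_seq_neq0.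
rewrite mulrC ler_pdivrMr; last by rewrite cmod_gt0 rGamma_seq_neq0.
exact: cmod_rGamma_seq_le.
Qed.

Lemma Gint_neq0 z : 0 < Re z -> Gint 1 z != 0.
Proof.
move=> z0; rewrite -cmod_gt0.
have [_ g0] := Gint_real_gt0 z0.
have := @cmod_Gint_ge z (`|Im z| / Re z) z0; rewrite divfK ?gt_eqF// => /(_ (lexx _)).
by move=> /(lt_le_trans g0); rewrite pmulr_rgt0// expR_gt0.
Qed.

Lemma cvg_rGamma_pos z : 0 < Re z ->
  (rGamma_seq z : nat -> R[i]^o) @ \oo --> ((Gint 1 z)^-1 : R[i]^o).
Proof.
move=> z0; rewrite -(@cvg_shiftS R[i]^o).
have -> : [sequence rGamma_seq z n.+1]_n = (fun n => (rGamma_seq z n.+1)^-1^-1).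
  by apply/funext => n; rewrite invrK.
exact: (cvgCV (Gint_neq0 z0) (cvg_rGamma_seqV1 z0)).
Qed.

Lemma cvg_ratio z : ((fun n => n.+1%:R / (z + n.+1%:R)) : nat -> R[i]^o) @ \oo --> (1 : R[i]^o).
Proof.
have h : ((fun n => 1 + (n.+1%:R^-1)%:C * z) : nat -> R[i]^o) @ \oo --> (1 : R[i]^o).
  rewrite -[X in _ --> X]addr0; apply: cvgD; first exact: cvg_cst.
  by rewrite -(mul0r z); apply: cvg_realM; exact: cvg_invS.
have -> : (fun n => n.+1%:R / (z + n.+1%:R)) =
          (fun n => (1 + (n.+1%:R^-1)%:C * z)^-1).
  apply/funext => n; rewrite fmorphV rmorph_nat -invf_div; congr (_^-1).
  by rewrite mulrDl divff ?pnatr_eq0// addrC [_ * z]mulrC.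
rewrite -[X in _ --> X]invr1.
exact: (cvgCV (oner_neq0 _) h).
Qed.

Lemma rGamma_seq_shift z n : z + n.+2%:R != 0 ->
  rGamma_seq z n.+1 =
  z * rGamma_seq (z + 1) n.+1 * (n.+1%:R / (z + 1 + n.+1%:R)).
Proof.
move=> zn; have zn' : z + 1 + n.+1%:R != 0 by rewrite addrAC -addrA natr1.
have n0 : n.+1%:R != 0 :> R[i] by rewrite pnatr_eq0.
rewrite !rGamma_seqE.
have -> : rising z n.+1 = z * rising (z + 1) n.+1 / (z + 1 + n.+1%:R).
  rewrite -risingSl [rising z n.+2]risingS; have -> : z + n.+2%:R = z + 1 + n.+1%:R.
    by rewrite addrAC -addrA natr1.
  by rewrite mulfK.
rewrite cpowD//; have -> : cpow (n.+1%:R : R[i]) 1 = n.+1%:R.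
  by rewrite natC cpow1_pos.
have f0 : (n.+1`!)%:R != 0 :> R[i] by rewrite pnatr_eq0 -lt0n fact_gt0.
have c0 := cpow_unit z n0.
have alg (B A F C N : R[i]) : A != 0 -> N != 0 -> F != 0 -> C != 0 ->
    z * B / A / (F * C) = z * (B / (F * (C * N))) * (N / A).
  by move=> hA hN hF hC; field; rewrite hA hN hF hC.
exact: alg.
Qed.

(** Extends convergence of Euler's formula one unit to the left. *)
Lemma cvg_rGamma_step z l : (rGamma_seq (z + 1) : nat -> R[i]^o) @ \oo --> (l : R[i]^o) ->
  (rGamma_seq z : nat -> R[i]^o) @ \oo --> (z * l : R[i]^o).
Proof.
move=> hl; rewrite -(@cvg_shiftS R[i]^o).
have h : ((fun n => z * rGamma_seq (z + 1) n.+1 * (n.+1%:R / (z + 1 + n.+1%:R)))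
    : nat -> R[i]^o) @ \oo --> (z * l : R[i]^o).
  rewrite -[X in _ --> X]mulr1; apply: cvgCM; last exact: cvg_ratio.
  apply: cvgCM; first exact: cvg_cst.
  by rewrite (@cvg_shiftS R[i]^o).
apply: cvg_trans h; apply: near_eq_cvg; near=> n.
have zn : z + n.+2%:R != 0.
  apply: Re_gt0_neq0; rewrite !cReE.
  have : - Re z < n%:R by near: n; exact: nbhs_infty_gtr.
  by rewrite -!natr1; lra.
by rewrite /= (rGamma_seq_shift zn).
Unshelve. all: end_near. Qed.

Lemma cvg_rGamma z : (rGamma_seq z : nat -> R[i]^o) @ \oo --> (rGamma z : R[i]^o).
Proof.
suff [l hl] : exists l : R[i], (rGamma_seq z : nat -> R[i]^o) @ \oo --> (l : R[i]^o).
  by rewrite /rGamma (cvgC_limE hl).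
have [N zN] : exists N : nat, - N%:R < Re z.
  exists (Num.bound `|Re z|).
  rewrite ltrNl (le_lt_trans (ler_norm _))// normrN.
  by apply: archi_boundP.
elim: N z zN => [|N IH] z zN.
  by exists (Gint 1 z)^-1; apply: cvg_rGamma_pos; rewrite oppr0 in zN.
have [|l hl] := IH (z + 1); last by exists (z * l); exact: cvg_rGamma_step.
rewrite cReE /=; move: zN; rewrite -natr1; lra.
Qed.

Lemma rGamma_cvgE z l : (rGamma_seq z : nat -> R[i]^o) @ \oo --> (l : R[i]^o) -> rGamma z = l.
Proof. exact: cvgC_limE. Qed.

Lemma rGamma_rec z : rGamma z = z * rGamma (z + 1).
Proof. by apply: rGamma_cvgE; apply: cvg_rGamma_step; exact: cvg_rGamma. Qed.

Lemma rGammaE z : 0 < Re z -> rGamma z = (Gint 1 z)^-1.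
Proof. by move=> z0; apply: rGamma_cvgE; exact: cvg_rGamma_pos. Qed.

Lemma GammaE z : 0 < Re z -> Gamma z = Gint 1 z.
Proof. by move=> z0; rewrite /Gamma rGammaE// invrK. Qed.

Lemma rGamma_neq0 z : 0 < Re z -> rGamma z != 0.
Proof. by move=> z0; rewrite rGammaE// invr_eq0 Gint_neq0. Qed.

(** [Gint_vline] reduces the value at [s] to the real point [Re s], where it is
    the limit of Euler's integrals rescaled by [Re s]. *)
Lemma Gint_Gamma s z : 0 < Re s -> 0 < Re z -> Gint s z = Gamma z / cpow s z.
Proof.
move=> s0 z0; have sn0 := Re_gt0_neq0 s0.
apply: (canRL (mulfK (cpow_unit z sn0))).
rewrite Gint_vline// GammaE//.
have h1 := cvg_rGamma_seqV s0 z0; have h2 := cvg_rGamma_seqV1 z0.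
exact: cvgC_unique h1 h2.
Qed.

End ReciprocalGamma.

(** * The value of Gamma at 1/2 *)

Section GammaHalf.
Variable R : realType.
Local Notation mu := (@lebesgue_measure R).
Local Notation D0 := (`]0, +oo[%classic : set R).
Implicit Types t x : R.

Local Notation G := (@gauss_integral_proof.integral0_gauss R).

Lemma integrable_gauss_segment a b : mu.-integrable `[a, b] (EFin \o @gauss_fun R).
Proof.
apply: continuous_compact_integrable; first exact: segment_compact.
by apply: continuous_subspaceT; exact: continuous_gauss_fun.
Qed.

Lemma is_derive_gauss_primitive x : 0 < x -> is_derive x (1 : R) G (gauss_fun x).
Proof.
move=> x0.
have [h1 h2] : derivable G x 1 /\ G^`()%classic x = gauss_fun x.
  apply: (@continuous_FTC1 R (@gauss_fun R) (BLeft 0) x (x + 1)).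
  - by rewrite ltrDl.
  - exact: integrable_gauss_segment.
  - by rewrite /= lte_fin.
  - exact: continuous_gauss_fun.
by apply: DeriveDef => //; rewrite -derive1E.
Qed.

(** For [G x] the integral of [e^(-u^2)] over [0, x], the function
    [2 G (sqrt t)] is a primitive of [t^(-1/2) e^(-t)]. *)
Lemma Gint_half : Gint 1 (2^-1) = (Num.sqrt (pi : R))%:C.
Proof.
have h0 : 0 < 2^-1 :> R by rewrite invr_gt0.
have e2 : 2^-1 = (2^-1 : R)%:C :> R[i] by rewrite fmorphV rmorph_nat.
have [gi _] := Gint_real_gt0 h0.
rewrite e2; apply: complex_eq; last by rewrite gi.
rewrite /Gint /cintegral /=.
have -> : \int[mu]_(t in D0) Re (kern 1 (2^-1)%:C t) =
          \int[mu]_(t in D0) rkern 1 2^-1 t.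
  by apply: eq_Rintegral => t _; rewrite kern1_real.
rewrite -[RHS]subr0.
apply: (@FTC_exhaust _ D0 _ (fun t => 2 * G (Num.sqrt t)) (fun n => n.+1%:R^-1) (fun n => n.+2%:R)).
- exact: measurable_D0.
- by apply: integrable_rkern.
- exact: lt_exhaust_itv0y.
- exact: sub_exhaust_itv0y.
- by move=> t; rewrite /= in_itv /= andbT; exact: exhaust_itv0y.
- move=> t; rewrite /= in_itv /= andbT => t0.
  have s0 : 0 < Num.sqrt t by rewrite sqrtr_gt0.
  have h := is_deriveZ (2 : R) (@is_derive1_comp _ G _ t _ _ (is_derive_gauss_primitive s0) (is_derive1_sqrt t0)).
  apply: (@is_derive_eq _ _ _ _ _ _ _ _ h).
  rewrite /GRing.scale /= /gauss_fun sqr_sqrtr ?ltW// /rkern mul1r.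
  have -> : (2^-1 - 1) * ln t = - ln (Num.sqrt t).
    by rewrite -powR12_sqrt ?ltW// ln_powR; lra.
  by rewrite [expR (- ln _)]expRN lnK ?posrE//; field; rewrite gt_eqF.
- move=> t; rewrite /= in_itv /= andbT => t0.
  have [h _] := cderive_kern 1 (2^-1)%:C t0.
  have -> : rkern 1 2^-1 = fun t => Re (kern 1 (2^-1)%:C t).
    by apply/funext => u; rewrite kern1_real.
  exact: is_derive_continuous h.
- rewrite -(mulr0 2); apply: cvgM; first exact: cvg_cst.
  have c := @parameterized_integral_cvg_left R 0 1 (@gauss_fun R) ltr01 (integrable_gauss_segment 0 1).
  have s : (fun n => Num.sqrt (n.+1%:R^-1) : R) @ \oo --> (0 : R).
    rewrite -[X in _ --> X](@sqrtr0 R).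
    by apply: (cvg_comp _ Num.sqrt (@cvg_invS R)); exact: sqrt_continuous.
  exact: (cvg_comp _ _ s c).
- have c := @gauss_integral_proof.cvg_integral0_gauss_sqr R.
  have s : (fun n => Num.sqrt (n.+2%:R) : R) @ \oo --> +oo.
    apply/cvgryPge => A; near=> n; apply: le_trans (ler_norm A) _.
    rewrite -sqrtr_sqr; apply: ler_wsqrtr.
    apply: (@le_trans _ _ n%:R); last by rewrite ler_nat -addn2 leq_addr.
    by near: n; exact: nbhs_infty_ger.
  have c2 := (cvg_comp _ _ s c).
  have c3 := cvg_comp _ _ c2 (@sqrt_continuous R (pi / 4)).
  have -> : Num.sqrt pi = 2 * Num.sqrt (pi / 4) :> R.
    rewrite -[X in X * _](@gtr0_norm R 2)// -sqrtr_sqr -sqrtrM ?sqr_ge0//.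
    by congr Num.sqrt; field.
  apply: cvgM; first exact: cvg_cst.
  have -> : (fun n => G (Num.sqrt n.+2%:R)) =
            (fun n => Num.sqrt (G (Num.sqrt n.+2%:R) ^+ 2)).
    apply/funext => n.
    by rewrite sqrtr_sqr ger0_norm// gauss_integral_proof.integral0_gauss_ge0.
  exact: c3.
Unshelve. all: end_near. Qed.

End GammaHalf.

(** * Legendre's duplication formula *)

Section Duplication.
Variable R : realType.
Implicit Types z : R[i].

Lemma rising_dup z n :
  rising (z / 2) n * rising ((z + 1) / 2) n = rising z n.*2.+1 / 4 ^+ n.+1.
Proof.
have two : (2 : R[i]) != 0 by rewrite pnatr_eq0.
elim: n => [|n IH].
  rewrite double0 risingS !rising0 expr1.
  by field.
rewrite doubleS !(risingS _ n) mulrACA IH.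
rewrite [rising z n.*2.+3]risingS [rising z n.*2.+2]risingS [4 ^+ n.+2]exprS.
have -> : n.*2.+3%:R = 2 * n.+1%:R + 1 :> R[i] by rewrite -natrM natr1 mul2n doubleS.
have -> : n.*2.+2%:R = 2 * n.+1%:R :> R[i] by rewrite -natrM mul2n doubleS.
have q : (4 : R[i]) ^+ n.+1 != 0 by rewrite expf_neq0// pnatr_eq0.
have alg (P N Q : R[i]) : Q != 0 -> P / Q * ((z / 2 + N) * ((z + 1) / 2 + N)) =
   P * (z + 2 * N) * (z + (2 * N + 1)) / (4 * Q).
  by move=> hq; field; rewrite hq.
exact: alg.
Qed.

(** The part of the quotient of Euler sequences in [rGamma_seq_dup] that does not
    depend on [z]. *)
Definition dup_factor n : R[i] :=
  (n.*2.+1)`!%:R / (4 ^+ n.+1 * n`!%:R ^+ 2 * cpow n%:R 2^-1).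

(** The even and the odd factors of the numerator of index [2n+1] at [z] are, up to
    powers of 2, the numerators of index [n] at [z/2] and [(z+1)/2]. *)
Lemma rGamma_seq_dup z n :
  rGamma_seq (z / 2) n.+1 * rGamma_seq ((z + 1) / 2) n.+1 =
  rGamma_seq z n.+1.*2.+1 * dup_factor n.+1 *
   cpow ((n.+1.*2.+1)%:R / n.+1%:R) z.
Proof.
have n0 : n.+1%:R != 0 :> R[i] by rewrite pnatr_eq0.
have n2 : n.+1.*2.+1%:R != 0 :> R[i] by rewrite pnatr_eq0.
have -> : cpow ((n.+1.*2.+1)%:R / n.+1%:R) z =
    cpow (n.+1.*2.+1)%:R z / cpow n.+1%:R z :> R[i].
  rewrite !natC -fmorphV -rmorphM cpow_posM ?invr_gt0//; congr (_ * _).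
  by rewrite !cpow_pos ?invr_gt0// lnV ?posrE// rmorphN mulrN cexpN.
rewrite !rGamma_seqE mulf_div rising_dup.
have -> : n.+1`!%:R * cpow n.+1%:R (z / 2) * (n.+1`!%:R * cpow n.+1%:R ((z + 1) / 2)) =
   n.+1`!%:R ^+ 2 * cpow n.+1%:R z * cpow n.+1%:R (2^-1) :> R[i].
  rewrite mulrACA -expr2 -[RHS]mulrA -!cpowD//; congr (_ * cpow _ _).
  by field.
rewrite /dup_factor.
have := cpow_unit z n0; have := cpow_unit 2^-1 n0; have := cpow_unit z n2.
have : n.+1`!%:R != 0 :> R[i] by rewrite pnatr_eq0 -lt0n fact_gt0.
have : n.+1.*2.+1`!%:R != 0 :> R[i] by rewrite pnatr_eq0 -lt0n fact_gt0.
have : 4 ^+ n.+2 != 0 :> R[i] by rewrite expf_neq0// pnatr_eq0.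
have alg (P Q A B C D E : R[i]) : Q != 0 -> A != 0 -> B != 0 -> C != 0 -> D != 0 -> E != 0 ->
    P / Q / (B ^+ 2 * E * D) =
    P / (A * C) * (A / (Q * B ^+ 2 * D)) * (C / E).
  by move=> h1 h2 h3 h4 h5 h6; field; rewrite h1 h2 h3 h4 h5 h6.
move=> h1 h2 h3 h4 h5 h6; exact: alg.
Qed.

Lemma cvg_two_ratio z :
  ((fun n => cpow ((n.+1.*2.+1)%:R / n.+1%:R) z) : nat -> R[i]^o) @ \oo -->
  (cpow 2 z : R[i]^o).
Proof.
have e n : (n.+1.*2.+1)%:R / n.+1%:R = 2 + n.+1%:R^-1 :> R.
  by rewrite -natr1 -mul2n natrM mulrDl mulfK ?pnatr_eq0// mul1r.
have c : (fun n => 2 + n.+1%:R^-1 : R) @ \oo --> (2 : R).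
  rewrite -[X in _ --> X]addr0; apply: cvgD; first exact: cvg_cst.
  exact: cvg_invS.
have t0 : 0 < 2 :> R by [].
have [d1 d2] := cderive_cpow z t0.
have e2 : (fun n => cpow ((n.+1.*2.+1)%:R / n.+1%:R : R[i]) z) =
   (fun n => cexp (z * (ln (2 + n.+1%:R^-1))%:C)).
  apply/funext => n; rewrite !natC -fmorphV -rmorphM /= e cpow_pos//.
rewrite e2 natC cpow_pos//; apply/cvg_complexP; split.
  exact: (cvg_comp _ _ c (is_derive_continuous d1)).
exact: (cvg_comp _ _ c (is_derive_continuous d2)).
Qed.

Lemma cvg_rGamma_odd z :
  ((fun n => rGamma_seq z n.+1.*2.+1) : nat -> R[i]^o) @ \oo --> (rGamma z : R[i]^o).
Proof.
have h : (fun n => n.+1.*2.+1) @ \oo --> \oo.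
  apply/cvgnyPge => A; near=> n; apply: (@leq_trans n).
    by near: n; exact: nbhs_infty_ge.
  by rewrite doubleS -addnn -!addnS leq_addr.
exact: (cvg_comp _ _ h (@cvg_rGamma R z)).
Unshelve. all: end_near. Qed.

Lemma cvg_rGamma_seq_dup z :
  ((fun n => rGamma_seq (z / 2) n.+1 * rGamma_seq ((z + 1) / 2) n.+1) : nat -> R[i]^o)
   @ \oo --> (rGamma (z / 2) * rGamma ((z + 1) / 2) : R[i]^o).
Proof.
apply: cvgCM.
  by move: (@cvg_rGamma R (z / 2)); rewrite -(@cvg_shiftS R[i]^o).
by move: (@cvg_rGamma R ((z + 1) / 2)); rewrite -(@cvg_shiftS R[i]^o).
Qed.

(** Being independent of [z], the factor is read off from [rGamma_seq_dup] at
    [z = 1], where all the other limits are known. *)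
Lemma cvg_dup_factor :
  ((fun n => dup_factor n.+1) : nat -> R[i]^o) @ \oo -->
  ((Num.sqrt (pi : R))%:C^-1 / 2 : R[i]^o).
Proof.
have h1 := @cvg_rGamma_seq_dup 1.
have h2 := cvgCM (@cvg_rGamma_odd 1) (@cvg_two_ratio 1).
have r1 : rGamma (1 : R[i]) != 0 by apply: rGamma_neq0 => /=.
have two : (2 : R[i]) != 0 by rewrite pnatr_eq0.
have c2 : cpow (2 : R[i]) 1 = 2 by rewrite natC cpow1_pos.
rewrite c2 in h2.
have l0 : rGamma (1 : R[i]) * 2 != 0 by rewrite mulf_neq0.
have h3 := cvgCM h1 (cvgCV l0 h2).
have half : rGamma (1 / 2 : R[i]) = (Num.sqrt (pi : R))%:C^-1.
  rewrite mul1r rGammaE ?Gint_half//.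
  have -> : 2^-1 = (2^-1 : R)%:C :> R[i] by rewrite fmorphV rmorph_nat.
  by rewrite /= invr_gt0.
have e : rGamma (1 / 2 : R[i]) * rGamma ((1 + 1) / 2) / (rGamma 1 * 2) =
    (Num.sqrt (pi : R))%:C^-1 / 2.
  rewrite half (_ : (1 + 1) / 2 = 1); last exact: divff.
  by rewrite [_ * 2]mulrC -mulf_div divff// mulr1.
rewrite -e.
suff -> : (fun n => dup_factor n.+1) = (fun n =>
   rGamma_seq (1 / 2) n.+1 * rGamma_seq ((1 + 1) / 2) n.+1 /
   (rGamma_seq 1 n.+1.*2.+1 * cpow ((n.+1.*2.+1)%:R / n.+1%:R) 1)) by exact: h3.
apply/funext => n; rewrite rGamma_seq_dup.
have a0 : rGamma_seq (1 : R[i]) n.+1.*2.+1 != 0 by apply: rGamma_seq_neq0 => /=.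
have b0 : cpow ((n.+1.*2.+1)%:R / n.+1%:R : R[i]) 1 != 0.
  by rewrite cpow_unit// mulf_neq0 ?invr_eq0 pnatr_eq0.
have alg (x y d : R[i]) : x != 0 -> y != 0 -> d = x * d * y / (x * y).
  by move=> h4 h5; field; rewrite h4 h5.
exact: alg.
Qed.

Lemma rGamma_duplication z :
  rGamma z = (Num.sqrt (pi : R))%:C * cpow 2 (1 - z) *
             (rGamma (z / 2) * rGamma ((z + 1) / 2)).
Proof.
have h1 := @cvg_rGamma_seq_dup z.
have h2 := cvgCM (@cvg_rGamma_odd z) cvg_dup_factor.
have h3 := cvgCM h2 (@cvg_two_ratio z).
have e : (fun n => rGamma_seq (z / 2) n.+1 * rGamma_seq ((z + 1) / 2) n.+1) =
    (fun n => rGamma_seq z n.+1.*2.+1 * dup_factor n.+1 *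
      cpow ((n.+1.*2.+1)%:R / n.+1%:R) z).
  by apply/funext => n; exact: rGamma_seq_dup.
rewrite e in h1.
have -> : rGamma (z / 2) * rGamma ((z + 1) / 2) =
    rGamma z * ((Num.sqrt (pi : R))%:C^-1 / 2) * cpow 2 z.
  exact: cvgC_unique h1 h3.
have two : (2 : R[i]) != 0 by rewrite pnatr_eq0.
have s0 : (Num.sqrt (pi : R))%:C != 0 :> R[i].
  by apply: realC_neq0; rewrite sqrtr_gt0 pi_gt0.
have p0 := cpow_unit z two.
have -> : cpow 2 (1 - z) = 2 / cpow 2 z :> R[i].
  by rewrite cpowD// cpowN// natC cpow1_pos.
have alg (S P Q T : R[i]) : S != 0 -> P != 0 -> T != 0 ->
    Q = S * (T / P) * (Q * (S^-1 / T) * P).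
  by move=> h4 h5 h6; field; rewrite h4 h5 h6.
exact: alg.
Qed.

End Duplication.

(** * Decay of 1/Gamma along arithmetic progressions *)

Section Growth.
Variable R : realType.
Implicit Types (a b w z x : R[i]) (alpha beta : R[i]) (M T : R).

Lemma cmod_rGamma_le w L M : 0 < Re w -> `|Im w| <= L * Re w -> 0 < M ->
  cmod (rGamma w) <= expR (L ^+ 2 * (1 + Re w) / 2) *
    (Re w * expR (M + 1) * expR (- (Re w * ln M))).
Proof.
move=> w0 wL M0.
have [_ g0] := Gint_real_gt0 w0.
have n0 : 0 < cmod (Gint 1 w) by rewrite cmod_gt0 Gint_neq0.
rewrite rGammaE// cmodV.
apply: (@le_trans _ _ (expR (L ^+ 2 * (1 + Re w) / 2) * (Re (Gint 1 (Re w)%:C))^-1)).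
  rewrite ler_pdivlMr// mulrC ler_pdivrMr//.
  exact: cmod_Gint_ge.
by apply: ler_wpM2l; [exact: expR_ge0|exact: Gint_real_inv_le].
Qed.

Lemma Re_arith beta alpha k :
  Re (beta + alpha * k%:R) = Re beta + Re alpha * k%:R.
Proof. by rewrite !cReE Im_nat mulr0 subr0. Qed.

Lemma Im_arith beta alpha k :
  Im (beta + alpha * k%:R) = Im beta + Im alpha * k%:R.
Proof. by rewrite !cImE Re_nat mulr0 add0r. Qed.

Lemma Re_arith_gt0 beta alpha k : 0 < Re beta -> 0 < Re alpha ->
  0 < Re (beta + alpha * k%:R).
Proof. by move=> b0 a0; rewrite Re_arith ltr_wpDr// mulr_ge0// ltW. Qed.

(** Both generators lie in the right half-plane, so the progression stays in a
    sector. *)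
Lemma arith_sector beta alpha : 0 < Re beta -> 0 < Re alpha ->
  exists L, forall k : nat,
    `|Im (beta + alpha * k%:R)| <= L * Re (beta + alpha * k%:R).
Proof.
move=> b0 a0; exists (`|Im beta| / Re beta + `|Im alpha| / Re alpha) => k.
have b1 := ltW b0; have a1 := ltW a0.
rewrite Re_arith Im_arith; apply: (le_trans (ler_normD _ _)).
rewrite normrM normr_nat mulrDr; apply: lerD.
  by rewrite mulrDl divfK ?gt_eqF// lerDl mulr_ge0 ?divr_ge0.
by rewrite mulrDl !mulrA divfK ?gt_eqF// lerDr !mulr_ge0 ?invr_ge0.
Qed.

Lemma succ_le_pow2 k : k.+1%:R <= 2 ^+ k :> R.
Proof. by rewrite -natrX ler_nat ltn_expl. Qed.

(** [M] stays free: it is a constant in [rGamma_arith_pos] but grows with the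
    integration variable in [term_le]. *)
Lemma cmod_rGamma_arith beta alpha : 0 < Re beta -> 0 < Re alpha ->
  exists A B, [/\ 0 < A, 0 < B & forall (k : nat) M, 0 < M ->
    cmod (rGamma (beta + alpha * k%:R)) <=
    A * B ^+ k * expR M * expR (- (Re (beta + alpha * k%:R) * ln M))].
Proof.
move=> b0 a0; have [L hL] := arith_sector b0 a0.
exists (expR (L ^+ 2 * (1 + Re beta) / 2) * (Re beta + Re alpha) * expR 1).
exists (expR (L ^+ 2 * Re alpha / 2) * 2); split.
- by rewrite !mulr_gt0 ?expR_gt0 ?addr_gt0.
- by rewrite mulr_gt0 ?expR_gt0.
move=> k M M0.
apply: (le_trans (cmod_rGamma_le (Re_arith_gt0 k b0 a0) (hL k) M0)).
rewrite !mulrA; apply: ler_wpM2r; first exact: expR_ge0.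
rewrite expRD [expR M * _]mulrC !mulrA; apply: ler_wpM2r; first exact: expR_ge0.
rewrite [leRHS]mulrAC; apply: ler_wpM2r; first exact: expR_ge0.
rewrite exprMn -expRM_natr [leRHS]mulrACA -expRD.
rewrite [X in expR X * _](_ : _ = L ^+ 2 * (1 + Re beta) / 2 + L ^+ 2 * Re alpha / 2 * k%:R); last first.
  by rewrite Re_arith; ring.
apply: ler_wpM2l; first exact: expR_ge0.
apply: (@le_trans _ _ ((Re beta + Re alpha) * k.+1%:R)).
  rewrite Re_arith -natr1 mulrDr mulr1 mulrDl.
  have : 0 <= Re beta * k%:R by rewrite mulr_ge0// ltW.
  lra.
by apply: ler_wpM2l; [rewrite ltW// addr_gt0|exact: succ_le_pow2].
Qed.

(** Superexponential decay: take [M] with [M^(Re alpha) = B T]. *)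
Lemma rGamma_arith_pos beta alpha T : 0 < Re beta -> 0 < Re alpha -> 0 < T ->
  exists K, forall k : nat, cmod (rGamma (beta + alpha * k%:R)) * T ^+ k <= K.
Proof.
move=> b0 a0 T0; have [A [B [A0 B0 h]]] := cmod_rGamma_arith b0 a0.
pose M := expR (ln (B * T) / Re alpha).
have M0 : 0 < M by exact: expR_gt0.
exists (A * expR M * expR (- (Re beta * ln M))) => k.
apply: (le_trans (ler_wpM2r (exprn_ge0 k (ltW T0)) (h k M M0))).
have -> : expR (- (Re (beta + alpha * k%:R) * ln M)) =
    expR (- (Re beta * ln M)) * (B * T) ^- k.
  have lM : ln M = ln (B * T) / Re alpha by rewrite /M expRK.
  rewrite Re_arith lM mulrDl opprD expRD; congr (_ * _).
  rewrite -[in RHS](@lnK R (B * T)) ?posrE ?mulr_gt0// -expRM_natr -expRN.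
  by congr expR; field; rewrite gt_eqF.
rewrite exprMn.
have p1 : B ^+ k != 0 by rewrite expf_neq0 ?gt_eqF.
have p2 : T ^+ k != 0 by rewrite expf_neq0 ?gt_eqF.
rewrite le_eqVlt; apply/orP; left; apply/eqP.
by move: (B ^+ k) (T ^+ k) p1 p2 => u v p1 p2; field; rewrite p1 p2.
Qed.

(** The functional equation gains one unit on the left, at the price of a factor
    linear in [k], absorbed by doubling [T]. *)
Lemma rGamma_arith beta alpha T : -1 < Re beta -> 0 < Re alpha -> 0 < T ->
  exists K, forall k : nat, cmod (rGamma (beta + alpha * k%:R)) * T ^+ k <= K.
Proof.
move=> b0 a0 T0.
have b1 : 0 < Re (beta + 1) by rewrite cReE /=; lra.
have [K hK] := rGamma_arith_pos b1 a0 (mulr_gt0 (ltr0n _ 2) T0).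
exists ((cmod beta + cmod alpha) * K) => k.
rewrite rGamma_rec cmodM addrAC -mulrA.
have h1 : cmod (beta + alpha * k%:R) <= (cmod beta + cmod alpha) * 2 ^+ k.
  apply: (le_trans (ler_cmodD _ _)); rewrite cmodM cmod_nat.
  apply: (@le_trans _ _ ((cmod beta + cmod alpha) * k.+1%:R)); last first.
    by apply: ler_wpM2l; [rewrite addr_ge0 ?cmod_ge0|exact: succ_le_pow2].
  rewrite -natr1 mulrDr mulr1 mulrDl.
  have := cmod_ge0 alpha.
  have : 0 <= cmod beta * k%:R by rewrite mulr_ge0 ?cmod_ge0.
  lra.
have t0 : 0 <= cmod (rGamma (beta + 1 + alpha * k%:R)) * T ^+ k.
  by rewrite mulr_ge0 ?cmod_ge0 ?exprn_ge0 ?ltW.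
apply: (le_trans (ler_wpM2r t0 h1)).
rewrite -mulrA; apply: ler_wpM2l; first by rewrite addr_ge0 ?cmod_ge0.
by rewrite mulrCA -exprMn.
Qed.

Lemma sum_half_le n : \sum_(0 <= k < n) (2^-1 : R) ^+ k <= 2.
Proof.
have -> : \sum_(0 <= k < n) (2^-1 : R) ^+ k = 2 - 2 * 2^-1 ^+ n.
  elim: n => [|n IH]; first by rewrite big_geq// expr0 mulr1 subrr.
  by rewrite big_nat_recr//= IH exprS; field.
by rewrite gerBl mulr_ge0// exprn_ge0// invr_ge0.
Qed.

Lemma real_geometric_cvg (u : nat -> R) K : (forall k, `|u k| <= K * 2^-1 ^+ k) ->
  cvgn (series u).
Proof.
move=> h; apply: normed_cvg.
apply: (@series_le_cvg _ _ (fun k => K * 2^-1 ^+ k)) => //.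
    by move=> k /=.
  by move=> k; apply: (le_trans _ (h k)).
apply: is_cvg_geometric_series.
by rewrite gtr0_norm ?invr_gt0// invf_lt1// ltr1n.
Qed.

Lemma complex_geometric_cvg (u : nat -> R[i]) K :
  (forall k, cmod (u k) <= K * 2^-1 ^+ k) ->
  cvgn (series u : nat -> R[i]^o) /\
  forall n, cmod (series u n) <= K * 2.
Proof.
move=> h; split.
  have hr : cvgn (series (fun k => Re (u k))).
    by apply: (@real_geometric_cvg _ K) => k; exact: le_trans (normr_Re_le _) (h k).
  have hi : cvgn (series (fun k => Im (u k))).
    by apply: (@real_geometric_cvg _ K) => k; exact: le_trans (normr_Im_le _) (h k).
  have er n : Re (series u n) = series (fun k => Re (u k)) n.
    rewrite /series /=; elim: n => [|n IH]; first by rewrite !big_geq.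
    by rewrite !big_nat_recr//= Re_add IH.
  have ei n : Im (series u n) = series (fun k => Im (u k)) n.
    rewrite /series /=; elim: n => [|n IH]; first by rewrite !big_geq.
    by rewrite !big_nat_recr//= Im_add IH.
  apply/cvg_ex; exists ((limn (series (fun k => Re (u k)))) +i* (limn (series (fun k => Im (u k))))).
  apply/cvg_complexP; split => /=.
    by under eq_fun do rewrite er.
  by under eq_fun do rewrite ei.
move=> n; apply: (le_trans (ler_cmod_sum _ _ _)).
apply: (@le_trans _ _ (\sum_(0 <= k < n) K * 2^-1 ^+ k)).
  by apply: ler_sum => k _; exact: h.
rewrite -big_distrr /=; apply: ler_wpM2l; last exact: sum_half_le.
by have := h 0%N; rewrite expr0 mulr1; apply: le_trans; exact: cmod_ge0.
Qed.

Lemma geometric_le (c q T K : R) k : 0 <= c -> 0 <= q -> 2 * q <= T -> 0 < T ->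
  c * T ^+ k <= K -> c * q ^+ k <= K * 2^-1 ^+ k.
Proof.
move=> c0 q0 qT T0 h.
apply: (@le_trans _ _ (c * T ^+ k * 2^-1 ^+ k)); last first.
  by apply: ler_wpM2r h; rewrite exprn_ge0// invr_ge0.
rewrite -mulrA -exprMn; apply: ler_wpM2l => //.
apply: lerXn2r; rewrite ?nnegrE// ?mulr_ge0 ?invr_ge0 ?(ltW T0)//.
by rewrite ler_pdivlMr// mulrC.
Qed.

Lemma mittag_leffler_cvg a b z : 0 < Re a -> -1 < Re b ->
  (series (fun k : nat => z ^+ k * rGamma (b + a * k%:R)) : nat -> R[i]^o) @ \oo -->
  (mittag_leffler a b z : R[i]^o).
Proof.
move=> a0 b0.
have T0 : 0 < 2 * cmod z + 1 by rewrite ltr_wpDl// mulr_ge0 ?cmod_ge0.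
have [K hK] := rGamma_arith b0 a0 T0.
suff [h _] : cvgn (series (fun k : nat => z ^+ k * rGamma (b + a * k%:R)) : nat -> R[i]^o) /\
  forall n, cmod (series (fun k : nat => z ^+ k * rGamma (b + a * k%:R)) n) <= K * 2 by exact: h.
apply: complex_geometric_cvg => k; rewrite cmodM cmodX mulrC.
apply: (@geometric_le _ _ (2 * cmod z + 1)) => //; rewrite ?cmod_ge0//.
by rewrite lerDl.
Qed.

End Growth.

(** * What existence of the termwise integrals implies *)

Section Existence.
Variable R : realType.
Local Notation mu := (@lebesgue_measure R).
Local Notation D0 := (`]0, +oo[%classic : set R).
Implicit Types (sigma u : R).

Lemma le_all_nat (c I : R) : 0 < c -> ~ (forall n : nat, c * n%:R <= I).
Proof.
move=> c0 h; have := h (Num.bound `|I / c|).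
apply/negP; rewrite -ltNge mulrC -ltr_pdivrMr//.
by apply: (le_lt_trans (ler_norm _)); apply: archi_boundP.
Qed.

(** Otherwise the integrand is at least 1 for [t >= 1]. *)
Lemma rkern_integrable_sigma sigma u : 1 <= u ->
  mu.-integrable D0 (EFin \o rkern sigma u) -> 0 < sigma.
Proof.
move=> u1 ir; rewrite ltNge; apply/negP => s0.
apply: (@le_all_nat 1 (\int[mu]_(t in D0) rkern sigma u t) ltr01) => n.
rewrite mul1r; case: n => [|n].
  by apply: Rintegral_ge0 => t _; exact: rkern_ge0.
have n1 : 1 < 1 + n.+1%:R :> R by rewrite ltrDl.
have := @integral_segment_cst R 1 (1 + n.+1%:R) 1 n1.
rewrite mul1r addrAC subrr add0r => h; rewrite -lee_fin -h.
apply: segment_integral_le => //.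
  by move=> t _; exact: rkern_ge0.
move=> t /andP[h1 h2]; rewrite ler01 /rkern -expRD -[leLHS]expR0 ler_expR /=.
have t0 : 0 <= t by rewrite (le_trans _ h1).
apply: addr_ge0; first by rewrite oppr_ge0 mulr_le0_ge0.
by apply: mulr_ge0; [rewrite subr_ge0|exact: ln_ge0].
Qed.

(** Otherwise the integrand is at least [e^(-sigma) / t] for [t <= 1]. *)
Lemma rkern_integrable_exponent sigma u : 0 < sigma ->
  mu.-integrable D0 (EFin \o rkern sigma u) -> 0 < u.
Proof.
move=> s0 ir; rewrite ltNge; apply/negP => u0.
apply: (@le_all_nat (expR (- sigma)) (\int[mu]_(t in D0) rkern sigma u t)).
  exact: expR_gt0.
case=> [|n].
  by rewrite mulr0; apply: Rintegral_ge0 => t _; exact: rkern_ge0.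
have e0 : 0 < expR (- n.+1%:R) :> R by exact: expR_gt0.
have e1 : expR (- n.+1%:R) < 1 :> R by rewrite expR_lt1 oppr_lt0.
have dF t : expR (- n.+1%:R) <= t <= 1 ->
    is_derive t (1 : R) (fun t => expR (- sigma) * ln t) (expR (- sigma) * t^-1).
  move=> /andP[h1 h2]; have t0 : 0 < t by exact: lt_le_trans h1.
  exact: (is_deriveZ (expR (- sigma)) (is_derive1_ln t0)).
have cf t : expR (- n.+1%:R) <= t <= 1 ->
    {for t, continuous (fun t : R => expR (- sigma) * t^-1)}.
  move=> /andP[h1 h2]; have t0 : 0 < t by exact: lt_le_trans h1.
  apply: cvgM; first exact: cvg_cst.
  by apply: cvgV; [rewrite gt_eqF|exact: cvg_id].
have h := FTC_segment e1 dF cf.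
have {h} h : (\int[mu]_(t in `[expR (- n.+1%:R), 1%R]) (expR (- sigma) * t^-1)%:E =
    (expR (- sigma) * n.+1%:R)%:E)%E.
  by rewrite h ln1 mulr0 expRK -EFinB sub0r mulrN opprK.
rewrite -lee_fin -h; apply: segment_integral_le => //.
- by move=> t _; exact: rkern_ge0.
- apply: subspace_continuous_measurable_fun; first exact: measurable_itv.
  apply: continuous_in_subspaceT => t /set_mem /=; rewrite in_itv /= => ht.
  exact: cf.
move=> t /andP[h1 h2]; have t0 : 0 < t by exact: lt_le_trans h1.
apply/andP; split; first by rewrite mulr_ge0 ?expR_ge0 ?invr_ge0 ?ltW.
rewrite /rkern -{1}(@lnK R t) ?posrE// -expRN.
have l0 : ln t <= 0 by exact: ln_le0.
apply: ler_pM; rewrite ?expR_ge0// ler_expR.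
  by rewrite lerN2 ler_piMr// ltW.
have : 0 <= u * ln t by rewrite mulr_le0.
lra.
Qed.

End Existence.

(** * Termwise integration of the Mittag-Leffler series *)

Section TermwiseIntegration.
Variable R : realType.
Local Notation mu := (@lebesgue_measure R).
Local Notation D0 := (`]0, +oo[%classic : set R).

Lemma laplace_exists_rkern (s w : R[i]) :
  laplace_exists (fun t : R => cpow t%:C (w - 1)) s ->
  mu.-integrable D0 (EFin \o rkern (Re s) (Re w)).
Proof.
move=> h; have := integrable_cmod (@measurable_D0 R) h.
apply: eq_integrable; first exact: measurable_D0.
move=> t; rewrite inE /= in_itv /= andbT => t0.
by rewrite cpow_pos// -/(kern s w t) cmod_kern.
Qed.

(** For [k] large, [Re (beta + alpha k) >= 1] and the integral forces [Re s > 0];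
    then [k = 0] forces [Re beta > 0]. *)
Lemma laplace_exists_half_planes (s beta alpha : R[i]) : 0 < Re alpha ->
  (forall k : nat, laplace_exists
     (fun t : R => cpow t%:C (beta + alpha * k%:R - 1)) s) ->
  0 < Re s /\ 0 < Re beta.
Proof.
move=> a0 h.
have s0 : 0 < Re s.
  pose N := Num.bound `|(1 - Re beta) / Re alpha|.
  apply: (rkern_integrable_sigma _ (laplace_exists_rkern (h N))).
  rewrite Re_arith -lerBlDl mulrC -ler_pdivrMr// ltW//.
  by apply: (le_lt_trans (ler_norm _)); apply: archi_boundP.
split=> //; have := laplace_exists_rkern (h 0%N).
by rewrite Re_arith mulr0 addr0; exact: rkern_integrable_exponent.
Qed.

Variables (alpha beta beta' b x s : R[i]).
(* One section for both formulas: {beta, beta'} = {b/2, (b+1)/2}. *)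
Let a := 2 * alpha.
Hypotheses (alpha0 : 0 < Re alpha) (beta0 : 0 < Re beta) (beta'0 : -1 < Re beta').
Hypotheses (s0 : 0 < Re s) (b0 : -1 < Re b).
Hypothesis dup : forall k : nat, rGamma (b + a * k%:R) =
  (Num.sqrt (pi : R))%:C * cpow 2 (1 - (b + a * k%:R)) *
  (rGamma (beta + alpha * k%:R) * rGamma (beta' + alpha * k%:R)).

Let coef k := x ^+ k * rGamma (b + a * k%:R).
Let term k t := coef k * kern s (beta + alpha * k%:R) t.

Lemma kern_arith k t : 0 < t ->
  kern s (beta + alpha * k%:R) t =
  cexp (- s * t%:C) * (cpow t%:C (beta - 1) * cpow t%:C alpha ^+ k).
Proof.
move=> t0; have tn0 := realC_neq0 t0.
rewrite /kern -cpow_pos// -cpowMn// -cpowD//; congr (_ * cpow _ _).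
by rewrite addrAC.
Qed.

(** By [dup], [coef k] contains two reciprocal Gammas. The one at
    [beta + alpha k], bounded with [M = 1 + Re s * t / 2], absorbs
    [t^(Re alpha * k)] up to a geometric factor and costs half of the exponential
    decay in [t]; the one at [beta' + alpha k] then beats every geometric factor.
    The bound is uniform in [t], up to one integrable function. *)
Lemma term_le : exists K, forall k (t : R), 0 < t ->
  cmod (term k t) <= K * rkern (Re s / 2) (Re beta) t * 2^-1 ^+ k.
Proof.
have [A [B [A0 B0 hAB]]] := cmod_rGamma_arith beta0 alpha0.
pose c := Re alpha.
pose D := expR (- (c * ln (Re s / 2))).
(* q collects the geometric factors; the choice T = 2 q + 1 leaves 2^-k. *)
pose q := cmod x * B * D.
have Dgt0 : 0 < D by exact: expR_gt0.
have q0 : 0 <= q by rewrite !mulr_ge0 ?cmod_ge0 ?ltW.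
have T0 : 0 < 2 * q + 1 by rewrite ltr_wpDl// mulr_ge0.
have [K hK] := rGamma_arith beta'0 alpha0 T0.
pose P := cmod (Num.sqrt (pi : R))%:C * 2 `^ (1 - Re b).
exists (P * A * expR 1 * K) => k t t0.
have half0 : 0 < Re s / 2 by rewrite divr_gt0.
have y0 : 0 < Re s / 2 * t by rewrite mulr_gt0.
have M0 : 0 < 1 + Re s / 2 * t by rewrite addr_gt0.
have h1 : cmod (rGamma (beta + alpha * k%:R)) * rkern (Re s) (Re (beta + alpha * k%:R)) t <=
    A * expR 1 * (B * D) ^+ k * rkern (Re s / 2) (Re beta) t.
  apply: (le_trans (ler_wpM2r (rkern_ge0 _ _ _) (hAB k _ M0))).
  rewrite exprMn /rkern /D -expRM_natr.
  rewrite (_ : A * B ^+ k * expR (1 + Re s / 2 * t) *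
     expR (- (Re (beta + alpha * k%:R) * ln (1 + Re s / 2 * t))) *
     (expR (- (Re s * t)) * expR ((Re (beta + alpha * k%:R) - 1) * ln t)) =
     A * B ^+ k * (expR (1 + Re s / 2 * t) *
     expR (- (Re (beta + alpha * k%:R) * ln (1 + Re s / 2 * t))) *
     (expR (- (Re s * t)) * expR ((Re (beta + alpha * k%:R) - 1) * ln t)))); last by rewrite !mulrA.
  rewrite (_ : A * expR 1 * (B ^+ k * expR (- (c * ln (Re s / 2)) * k%:R)) *
     (expR (- (Re s / 2 * t)) * expR ((Re beta - 1) * ln t)) =
     A * B ^+ k * (expR 1 * expR (- (c * ln (Re s / 2)) * k%:R) *
     (expR (- (Re s / 2 * t)) * expR ((Re beta - 1) * ln t)))); last by ring.
  apply: ler_wpM2l; first by rewrite mulr_ge0 ?exprn_ge0 ?ltW.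
  rewrite -!expRD ler_expR Re_arith -/c.
  have l1 : 0 <= ln (1 + Re s / 2 * t) by rewrite ln_ge0// lerDl ltW.
  have l2 : ln (Re s / 2) + ln t <= ln (1 + Re s / 2 * t).
    by rewrite -lnM ?posrE// ler_ln ?posrE// lerDr.
  have h2 : 0 <= Re beta * ln (1 + Re s / 2 * t) by rewrite mulr_ge0 ?(ltW beta0).
  have ck : 0 <= c * k%:R by rewrite mulr_ge0 ?(ltW alpha0).
  have h3 := ler_wpM2l ck l2.
  have e : Re s * t = Re s / 2 * t * 2 by field.
  rewrite e; move: h2 h3; move: (Re s / 2 * t) => y; move: (ln (1 + y)) (ln (Re s / 2)) (ln t) => u v w.
  rewrite mulrDr => h2 h3.
  lra.
have h2 : cmod (coef k) <= cmod x ^+ k * P *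
    (cmod (rGamma (beta + alpha * k%:R)) * cmod (rGamma (beta' + alpha * k%:R))).
  rewrite /coef dup !cmodM cmodX -!mulrA; apply: ler_wpM2l.
    by rewrite exprn_ge0 ?cmod_ge0.
  apply: ler_wpM2l; first exact: cmod_ge0.
  apply: ler_wpM2r; first by rewrite mulr_ge0 ?cmod_ge0.
  rewrite natC cmod_cpow_pos// ler_powR ?ler1n//.
  have -> : Re (1 - (b + 2%:C * (alpha * k%:R))) = 1 - (Re b + 2 * (c * k%:R)).
    by rewrite Re_add Re_opp [Re (b + _)]Re_add Re_mulR Re_mul Re_nat Im_nat mulr0 subr0.
  by rewrite lerD2l lerN2 lerDl mulr_ge0// mulr_ge0// ltW.
have h3 := geometric_le (cmod_ge0 _) q0 _ T0 (hK k).
rewrite lerDl ler01 in h3; move/(_ isT) : h3 => h3.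
rewrite /term cmodM cmod_kern.
apply: (le_trans (ler_wpM2r (rkern_ge0 _ _ _) h2)).
set g1 := cmod (rGamma (beta + _)); set g2 := cmod (rGamma (beta' + _)).
rewrite -/g1 -/g2 in h1 h3.
have xk : 0 <= cmod x ^+ k by rewrite exprn_ge0 ?cmod_ge0.
have P0 : 0 <= P by rewrite mulr_ge0 ?cmod_ge0 ?powR_ge0.
have g20 : 0 <= g2 by exact: cmod_ge0.
apply: (@le_trans _ _ (cmod x ^+ k * P * g2 *
   (A * expR 1 * (B * D) ^+ k * rkern (Re s / 2) (Re beta) t))).
  rewrite (_ : cmod x ^+ k * P * (g1 * g2) * _ = cmod x ^+ k * P * g2 *
    (g1 * rkern (Re s) (Re (beta + alpha * k%:R)) t)); last by ring.
  exact: ler_wpM2l (mulr_ge0 (mulr_ge0 xk P0) g20) _ _ h1.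
have -> : cmod x ^+ k * P * g2 * (A * expR 1 * (B * D) ^+ k * rkern (Re s / 2) (Re beta) t) =
    P * A * expR 1 * rkern (Re s / 2) (Re beta) t * (g2 * q ^+ k).
  by rewrite /q -[cmod x * B * D]mulrA [in RHS]exprMn; ring.
have -> : P * A * expR 1 * K * rkern (Re s / 2) (Re beta) t * 2^-1 ^+ k =
    P * A * expR 1 * rkern (Re s / 2) (Re beta) t * (K * 2^-1 ^+ k) by ring.
apply: ler_wpM2l h3.
exact: mulr_ge0 (mulr_ge0 (mulr_ge0 P0 (ltW A0)) (expR_ge0 1)) (rkern_ge0 _ _ _).
Qed.

Let f t := cpow t%:C (beta - 1) * mittag_leffler a b (x * cpow t%:C alpha).

Lemma sum_term n t : 0 < t ->
  \sum_(0 <= k < n) term k t = cexp (- s * t%:C) * cpow t%:C (beta - 1) *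
    series (fun k : nat => (x * cpow t%:C alpha) ^+ k * rGamma (b + a * k%:R)) n.
Proof.
move=> t0; rewrite /series /= big_distrr /=; apply: eq_bigr => k _.
rewrite /term /coef kern_arith// exprMn.
have alg (X G E P T : R[i]) : X * G * (E * (P * T)) = E * P * (X * T * G) by ring.
exact: alg.
Qed.

(** Here [4^alpha = 2^a] and the Gamma factor cancels one of the two reciprocal
    Gammas given by [dup]. *)
Lemma prefactor_term k : coef k * (Gamma (beta + alpha * k%:R) / cpow s (beta + alpha * k%:R)) =
  (Num.sqrt (pi : R))%:C / (cpow 2 (b - 1) * cpow s beta) *
  ((x / cpow (4 * s) alpha) ^+ k * rGamma (beta' + alpha * k%:R)).
Proof.
have sn0 := Re_gt0_neq0 s0.
have two : (2 : R[i]) != 0 by rewrite pnatr_eq0.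
have g0 := rGamma_neq0 (Re_arith_gt0 k beta0 alpha0).
have e4 : cpow (4 * s) alpha = cpow 2 a * cpow s alpha.
  rewrite natC cpowMr// /a; congr (_ * _).
  have -> : 4 = 2 * 2 :> R by rewrite -natrM.
  by rewrite cpow_posM// [2 * alpha]mulrDl mul1r cpowD// -natC.
have e2 : cpow 2 (1 - (b + a * k%:R)) = (cpow 2 (b - 1) * cpow 2 a ^+ k)^-1 :> R[i].
  rewrite -cpowMn// -cpowD// -cpowN//; congr (cpow _ _); ring.
rewrite /coef dup /Gamma e4 e2 (cpowD _ _ sn0) cpowMn// expr_div_n exprMn.
have p1 := cpow_unit beta sn0; have p2 := cpow_unit alpha sn0.
have p3 := cpow_unit (b - 1) two; have p4 := cpow_unit a two.
have alg (X S G G' U V W Z : R[i]) : G != 0 -> U != 0 -> V != 0 -> W != 0 -> Z != 0 ->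
    X * (S * (U * V)^-1 * (G * G')) * (G^-1 / (W * Z)) =
    S / (U * W) * (X / (V * Z) * G').
  by move=> h1 h2 h3 h4 h5; field; rewrite h1 h2 h3 h4 h5.
by apply: alg => //; rewrite expf_neq0.
Qed.

(** The integrals of the partial sums converge to the left-hand side by dominated
    convergence, and they are the partial sums of the right-hand side. *)
Lemma laplace_mittag_leffler : laplace_exists f s ->
  laplace f s = (Num.sqrt (pi : R))%:C / (cpow 2 (b - 1) * cpow s beta) *
    mittag_leffler alpha beta' (x / cpow (4 * s) alpha).
Proof.
move=> fex.
have a0 : 0 < Re a by rewrite /a natC Re_mulR mulr_gt0.
have [K hK] := term_le.
have mD := @measurable_D0 R.
have ki k : cintegrable D0 (kern s (beta + alpha * k%:R)).
  by apply: cintegrable_kern => //; exact: Re_arith_gt0.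
have ti k : cintegrable D0 (term k) by exact: cintegrableZ.
have half0 : 0 < Re s / 2 by rewrite divr_gt0.
have gi : mu.-integrable D0 (EFin \o (fun t => K * 2 * rkern (Re s / 2) (Re beta) t)).
  by apply: real_integrableZ => //; exact: integrable_rkern.
have h1 n : cmeasurable D0 (fun t => \sum_(0 <= k < n) term k t).
  exact: (cintegrable_cmeasurable (cintegrable_sum n mD ti).1).
have h2 t : D0 t -> ((fun n => \sum_(0 <= k < n) term k t) : nat -> R[i]^o) @ \oo -->
    (cexp (- s * t%:C) * f t : R[i]^o).
  rewrite /= in_itv /= andbT => t0.
  have -> : (fun n => \sum_(0 <= k < n) term k t) =
     (fun n => cexp (- s * t%:C) * cpow t%:C (beta - 1) *
       series (fun k : nat => (x * cpow t%:C alpha) ^+ k * rGamma (b + a * k%:R)) n).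
    by apply/funext => n; exact: sum_term.
  rewrite /f mulrA; apply: cvgCM; first exact: cvg_cst.
  exact: mittag_leffler_cvg.
have h3 n t : D0 t -> cmod (\sum_(0 <= k < n) term k t) <=
    K * 2 * rkern (Re s / 2) (Re beta) t.
  rewrite /= in_itv /= andbT => t0.
  rewrite mulrAC.
  exact: ((complex_geometric_cvg (fun k => hK k t t0)).2 n).
have [_ c1] := cdominated_convergence mD h1 (cintegrable_cmeasurable fex) h2 gi h3.
have c2 : ((fun n => (Num.sqrt (pi : R))%:C / (cpow 2 (b - 1) * cpow s beta) *
    series (fun k : nat => (x / cpow (4 * s) alpha) ^+ k * rGamma (beta' + alpha * k%:R)) n)
    : nat -> R[i]^o) @ \oo -->
    ((Num.sqrt (pi : R))%:C / (cpow 2 (b - 1) * cpow s beta) *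
    mittag_leffler alpha beta' (x / cpow (4 * s) alpha) : R[i]^o).
  by apply: cvgCM; [exact: cvg_cst|exact: mittag_leffler_cvg].
have e : (fun n => cintegral D0 (fun t => \sum_(0 <= k < n) term k t)) =
  (fun n => (Num.sqrt (pi : R))%:C / (cpow 2 (b - 1) * cpow s beta) *
    series (fun k : nat => (x / cpow (4 * s) alpha) ^+ k * rGamma (beta' + alpha * k%:R)) n).
  apply/funext => n; rewrite (cintegrable_sum n mD ti).2 /series /= big_distrr /=.
  apply: eq_bigr => k _; rewrite /term cintegralZ// -/(Gint _ _) Gint_Gamma//.
    exact: prefactor_term.
  exact: Re_arith_gt0.
rewrite e in c1.
exact: (cvgC_unique c1 c2).
Qed.

End TermwiseIntegration.

Theorem mainTheorem11 (R : realType) (a b x s : R[i])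
    (ha : 0 < complex.Re a) :
  (laplace_exists
     (fun t : R => cpow t%:C (b / 2 - 1) *
        mittag_leffler a b (x * cpow t%:C (a / 2))) s ->
   (forall k : nat, laplace_exists
     (fun t : R => cpow t%:C (b / 2 + a / 2 * k%:R - 1)) s) ->
   cvgn (series (fun k : nat =>
     x ^+ k * rGamma (b + a * k%:R) *
       (Gamma (b / 2 + a / 2 * k%:R) /
          cpow s (b / 2 + a / 2 * k%:R)) : R[i]^o)) ->
   laplace
     (fun t : R => cpow t%:C (b / 2 - 1) *
        mittag_leffler a b (x * cpow t%:C (a / 2))) s =
   (Num.sqrt (pi : R))%:C / (cpow 2 (b - 1) * cpow s (b / 2)) *
     mittag_leffler (a / 2) ((b + 1) / 2)
       (x / cpow (4 * s) (a / 2)))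
  /\
  (laplace_exists
     (fun t : R => cpow t%:C ((b + 1) / 2 - 1) *
        mittag_leffler a b (x * cpow t%:C (a / 2))) s ->
   (forall k : nat, laplace_exists
     (fun t : R => cpow t%:C ((b + 1) / 2 + a / 2 * k%:R - 1)) s) ->
   cvgn (series (fun k : nat =>
     x ^+ k * rGamma (b + a * k%:R) *
       (Gamma ((b + 1) / 2 + a / 2 * k%:R) /
          cpow s ((b + 1) / 2 + a / 2 * k%:R)) : R[i]^o)) ->
   laplace
     (fun t : R => cpow t%:C ((b + 1) / 2 - 1) *
        mittag_leffler a b (x * cpow t%:C (a / 2))) s =
   (Num.sqrt (pi : R))%:C / (cpow 2 (b - 1) * cpow s ((b + 1) / 2)) *
     mittag_leffler (a / 2) (b / 2)
       (x / cpow (4 * s) (a / 2))).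
Proof.
have two : (2 : R[i]) != 0 by rewrite pnatr_eq0.
have a2 : a = 2 * (a / 2) by rewrite mulrC divfK.
have half (z : R[i]) : Re (z / 2) = Re z / 2.
  have -> : z / 2 = (2^-1 : R)%:C * z by rewrite fmorphV rmorph_nat mulrC.
  by rewrite Re_mulR mulrC.
have al0 : 0 < Re (a / 2) by rewrite half divr_gt0.
have e1 k : (b + a * k%:R) / 2 = b / 2 + a / 2 * k%:R by rewrite mulrDl mulrAC.
have e2 k : (b + a * k%:R + 1) / 2 = (b + 1) / 2 + a / 2 * k%:R.
  by rewrite addrAC mulrDl [a * _ / 2]mulrAC.
split=> fex /(laplace_exists_half_planes al0)[s0 be0] _.
  have b0 : 0 < Re b by move: be0; rewrite half; lra.
  have main := @laplace_mittag_leffler R (a / 2) (b / 2) ((b + 1) / 2) b x s.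
  rewrite -a2 in main; apply: main => //.
  - by rewrite half cReE /=; lra.
  - lra.
  - by move=> k; rewrite rGamma_duplication e1 e2.
have b0 : -1 < Re b by move: be0; rewrite half cReE /=; lra.
have main := @laplace_mittag_leffler R (a / 2) ((b + 1) / 2) (b / 2) b x s.
rewrite -a2 in main; apply: main => //.
- by rewrite half; lra.
- by move=> k; rewrite rGamma_duplication e1 e2 [rGamma (b / 2 + _) * _]mulrC.
Qed.
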